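(* Let $K$ be a field and let $\mathsf X$ be a nonempty one-sided subshift over a finite alphabet, with associated groupoid $G(\widehat{\mathcal U},\widehat\sigma)$ and unital subshift algebra $\widetilde{\mathcal A}_K(\mathsf X)=A_K(G(\widehat{\mathcal U},\widehat\sigma))$ with its $\mathbb Z$-grading. Then the following are equivalent: (1) $\widetilde{\mathcal A}_K(\mathsf X)$ is graded just infinite; (2) $G(\widehat{\mathcal U},\widehat\sigma)$ is minimal; (3) $\widetilde{\mathcal A}_K(\mathsf X)$ is graded simple; (4) $\mathsf X$ is hyper cofinal. Moreover, if $\mathsf X$ is finite, conditions (1), (2), (3) and (4) are also equivalent to: (5) $\widetilde{\mathcal A}_K(\mathsf X)$ is just infinite; (6) $G(\widehat{\mathcal U},\widehat\sigma)$ is transitive.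
   Context: Let $\mathscr A$ be the alphabet and $\mathsf X\subseteq\mathscr A^{\mathbb N}$ a one-sided subshift (a subset closed for the product of discrete topologies with $\sigma(\mathsf X)\subseteq\mathsf X$), with shift $\sigma(x_0x_1x_2\cdots)=x_1x_2\cdots$. Let $\mathcal L_{\mathsf X}$ be the set of finite words appearing in points of $\mathsf X$, including the empty word $\omega$; $|\alpha|$ is the length of $\alpha$. For $\alpha,\beta\in\mathcal L_{\mathsf X}$ put $C(\alpha,\beta)=\{\beta x\in\mathsf X:\alpha x\in\mathsf X\}$ and $F_\alpha=\{y\in\mathsf X:\alpha y\in\mathsf X\}$; for a letter $a$ put $Z_a=\{x\in\mathsf X:x_0=a\}=C(\omega,a)$. For finite $B\subseteq\mathcal L_{\mathsf X}$ put $F_B=\bigcap_{\beta\in B}F_\beta$. Hyper cofinality: for $x\in\mathsf X$ and finite $B\subseteq\mathcal L_{\mathsf X}$, $\operatorname{Cost}(B,x)=\inf\{|\alpha|+|\gamma|:\alpha,\gamma\in\mathcal L_{\mathsf X}\text{ and }x\in C(\beta\gamma,\alpha)\text{ for all }\beta\in B\}$, with $\inf\emptyset=\infty$. $\mathsf X$ is hyper cofinal if $\sup_{x\in\mathsf X}\operatorname{Cost}(B,x)<\infty$ for all finite $B\subseteq\mathcal L_{\mathsf X}$ with $F_B\ne\emptyset$. Let $\mathcal U$ be the Boolean algebra of subsets of $\mathsf X$ generated by all $C(\alpha,\beta)$, and $\widehat{\mathcal U}$ its Stone space of ultrafilters, with topology generated by the sets $O_A=\{\xi\in\widehat{\mathcal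 U}:A\in\xi\}$, $A\in\mathcal U$. Let $\operatorname{dom}(\widehat\sigma)=\bigcup_{a\in\mathscr A}O_{Z_a}$ and, for $\xi\in O_{Z_a}$, let $\widehat\sigma(\xi)=\{B\in\mathcal U:\{y\in Z_a:\sigma(y)\in B\}\in\xi\}$; this is a local homeomorphism $\operatorname{dom}(\widehat\sigma)\to\widehat{\mathcal U}$, mapping $O_{Z_a}$ homeomorphically onto $O_{F_a}$. For a local homeomorphism $\tau:\operatorname{dom}(\tau)\to Y$ with $\operatorname{dom}(\tau)$ open in a totally disconnected locally compact Hausdorff space $Y$ (iterates having their natural domains, $\tau^0=\mathrm{id}_Y$), the Deaconu--Renault groupoid is $G(Y,\tau)=\{(x,k,y)\in Y\times\mathbb Z\times Y:\exists\,m,n\ge0,\ k=m-n,\ x\in\operatorname{dom}(\tau^m),\ y\in\operatorname{dom}(\tau^n),\ \tau^m(x)=\tau^n(y)\}$ with $r(x,k,y)=x$, $s(x,k,y)=y$, $(x,k,y)(y,\ell,z)=(x,k+\ell,z)$, $(x,k,y)^{-1}=(y,-k,x)$, unit space identified with $Y$, and topology generated by the sets $\{(x,m-n,y):x\in U,y\in V,\tau^m(x)=\tau^n(y)\}$ with $U\subseteq\operatorname{dom}(\tau^m)$, $V\subseteq\operatorname{dom}(\tau^n)$ open and $\tau^m|_U,\tau^n|_V$ homeomorphisms onto their images. It is an ample Hausdorff groupoid. The orbit of $u\in Y$ is $\{r(\gamma):s(\gamma)=u\}$; the groupoid is minimal if every orbit is dense in $Y$ and transitive if there is exactly one orbit.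 The Steinberg algebra is $A_K(G(Y,\tau))=\mathrm{span}_K\{1_U:U\text{ a compact open bisection}\}$ with convolution product, $1_U*1_V=1_{UV}$ (a bisection is a set on which $r$ and $s$ are injective), $\mathbb Z$-graded via $c(x,k,y)=k$ with degree-$m$ component $\mathrm{span}_K\{1_U:U\subseteq c^{-1}(m)\text{ a compact open bisection}\}$. A $K$-algebra $A$ is just infinite if $\dim_KA=\infty$ and $\dim_KA/I<\infty$ for every nonzero ideal $I$. A graded ideal of $A=\bigoplus_mA_m$ is an ideal $I$ with $I=\bigoplus_m(A_m\cap I)$. A graded algebra $A$ is graded just infinite if $\dim_KA=\infty$ and $\dim_KA/J<\infty$ for every nonzero graded ideal $J$; it is graded simple if its only graded ideals are $0$ and $A$. *)

(* Defs.v *)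
From HB Require Import structures.
From mathcomp Require Import all_boot all_order all_algebra.
From mathcomp Require Import all_classical topology numfun.

Set Implicit Arguments.
Unset Strict Implicit.
Unset Printing Implicit Defensive.

Import Order.TTheory GRing.Theory Num.Theory.

Local Open Scope classical_set_scope.
Local Open Scope ring_scope.

Section BooleanAlgebras.
Variables (T : Type) (X : set T).
Implicit Types (U F : set (set T)) (B C : set T).

Definition boolean_algebra_on U :=
  [/\ forall B, U B -> B `<=` X, U X,
      forall B, U B -> U (X `\` B) &
      forall B C, U B -> U C -> U (B `&` C)].

Definition generated_algebra (G : set (set T)) : set (set T) :=
  smallest boolean_algebra_on G.

Definition bfilter U F :=
  [/\ F `<=` U, F X, ~ F set0,
      forall B C, F B -> F C -> F (B `&` C) &
      forall B C, F B -> U C -> B `<=` C -> F C].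

Definition bultrafilter U F :=
  bfilter U F /\ forall F', bfilter U F' -> F `<=` F' -> F' = F.

Lemma generated_algebraP (G : set (set T)) :
  (forall B, G B -> B `<=` X) -> boolean_algebra_on (generated_algebra G).
Proof.
move=> GX; split.
- suff sub : generated_algebra G `<=` [set D | D `<=` X] by move=> B /sub.
  apply: smallest_sub => //; split=> //= D E DX _.
  by apply: subset_trans DX; exact: subIsetl.
- by move=> M [[]].
- by move=> B GB M MG; case: (MG) => [[_ _ MD _] _]; apply: MD; exact: GB.
- move=> B C GB GC M MG; case: (MG) => [[_ _ _ MI] _].
  by apply: MI; [exact: GB|exact: GC].
Qed.

Lemma bultrafilterP U F : boolean_algebra_on U ->
  bultrafilter U F <->
  bfilter U F /\ forall B, U B -> F B \/ F (X `\` B).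
Proof.
move=> [UX UT UD UI]; split=> [[filF maxF]|[filF primeF]]; split=> //.
- move=> B UB; case: (filF) => [FU FT F0 FI FS].
  have [[C FC CB0]|nF] := pselect (exists2 C, F C & C `&` B = set0).
    right; apply: (FS C) => //; first exact: UD.
    move=> x Cx; split; first exact: UX (FU _ FC) _ Cx.
    by move=> Bx; have : set0 x by rewrite -CB0.
  left; pose F' := [set D | U D /\ exists2 C, F C & C `&` B `<=` D].
  rewrite -(maxF F').
  + by split=> //; exists X => //; exact: subIsetr.
  + split.
    * by move=> D [].
    * by split=> //; exists X => //; apply: subset_trans (UX _ UB);
        exact: subIsetr.
    * move=> [_ [C FC]]; rewrite subset0 => CB.
      by apply: nF; exists C.
    * move=> D E [UD' [C FC CD]] [UE [C' FC' CE]]; split; first exact: UI.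
      exists (C `&` C'); first exact: FI.
      move=> x [[Cx C'x] Bx]; split; [exact: CD|exact: CE].
    * move=> D E [UD' [C FC CD]] UE DE; split=> //; exists C => //.
      exact: subset_trans DE.
  + move=> D FD; split; first exact: FU.
    by exists D => //; exact: subIsetl.
- move=> F' [F'U F'T F'0 F'I F'S] FF'; apply/seteqP; split=> // B F'B.
  have [//|FXB] := primeF B (F'U _ F'B).
  exfalso; apply: F'0; have := F'I _ _ F'B (FF' _ FXB).
  by rewrite setIDA setIC -setIDA setDv setI0.
Qed.

End BooleanAlgebras.

Definition stone_space (T : Type) (X : set T) (U : set (set T)) :=
  {xi : set (set T) | bultrafilter X U xi}.

Section StoneTopology.
Variables (T : Type) (X : set T) (U : set (set T)).

Definition stone_open (B : set T) : set (stone_space X U) :=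
  [set xi | sval xi B].

HB.instance Definition _ := gen_eqMixin (stone_space X U).
HB.instance Definition _ := gen_choiceMixin (stone_space X U).
HB.instance Definition _ :=
  isSubBaseTopological.Build (stone_space X U) (stone_open @` U) id.

End StoneTopology.

Section Words.
Variable A : Type.

Definition shift (x : nat -> A) : nat -> A := fun n => x n.+1.

Definition wcons (a : A) (x : nat -> A) : nat -> A :=
  fun n => if n is m.+1 then x m else a.

Definition wcat (w : seq A) (x : nat -> A) : nat -> A := foldr wcons x w.

Definition factor (x : nat -> A) (k n : nat) : seq A :=
  mkseq (fun i => x (k + i)%N) n.

Lemma wcat_cat v w x : wcat (v ++ w) x = wcat v (wcat w x).
Proof. exact: foldr_cat. Qed.

Lemma wcons_shift x : wcons (x 0%N) (shift x) = x.
Proof. by apply/funext => -[]. Qed.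

Lemma factor_wcat w x : factor (wcat w x) 0 (size w) = w.
Proof.
elim: w => //= a w IHw; rewrite /factor /mkseq /= (iotaDl 1) -map_comp.
by congr (_ :: _); rewrite -[RHS]IHw.
Qed.

End Words.

Arguments shift {A} x n.

Record subshift (A : finType) := Subshift {
  subshift_set :> set (nat -> A);
  subshift_closed :
    closed (subshift_set :
              set (prod_topology (fun _ : nat => discrete_topology A)));
  subshift_shift : shift @` subshift_set `<=` subshift_set
}.

Section Subshift.
Variables (A : finType) (S : subshift A).
Local Notation X := (subshift_set S).
Implicit Types (x y : nat -> A) (a : A) (alpha beta gamma : seq A).

Definition language : set (seq A) :=
  [set w | exists x k, X x /\ w = factor x k (size w)].

Definition cyl alpha beta : set (nat -> A) :=
  [set x | exists y, [/\ x = wcat beta y, X (wcat beta y) & X (wcat alpha y)]].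

Definition follower alpha : set (nat -> A) :=
  [set y | X y /\ X (wcat alpha y)].

Definition letter_cyl a : set (nat -> A) := [set x | X x /\ x 0%N = a].

Definition followers (B : set (seq A)) : set (nat -> A) :=
  [set y | X y /\ forall beta, B beta -> follower beta y].

Definition cost_set (B : set (seq A)) x : set nat :=
  [set n | exists alpha gamma,
    [/\ language alpha, language gamma, n = (size alpha + size gamma)%N &
        forall beta, B beta -> cyl (beta ++ gamma) alpha x]].

(* values in nat + {oo}, with oo encoded by None *)
Definition Cost (B : set (seq A)) x : option nat :=
  match pselect (exists n, `[< cost_set B x n >]) with
  | left h => Some (ex_minn h)
  | right _ => None
  end.

Definition hyper_cofinal :=
  forall B : set (seq A), finite_set B -> B `<=` language ->
    followers B !=set0 ->
  exists N : nat, forall x, X x -> exists2 n, Cost B x = Some n & (n <= N)%N.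

Definition subshift_algebra_sets : set (set (nat -> A)) :=
  generated_algebra X
    [set B | exists alpha beta,
      [/\ language alpha, language beta & B = cyl alpha beta]].

Definition subshift_stone := stone_space X subshift_algebra_sets.

Let U := subshift_algebra_sets.

Lemma cyl_letter a : cyl [::] [:: a] = letter_cyl a.
Proof.
apply/seteqP; split=> [x [y [-> Xay Xy]]|x [Xx xa]] //=.
exists (shift x); rewrite /= -xa wcons_shift; split=> //.
by apply: (@subshift_shift _ S); exists x.
Qed.

Lemma language_factor x k n : X x -> language (factor x k n).
Proof. by move=> Xx; exists x, k; rewrite size_mkseq. Qed.

Lemma language_wcat w x : X (wcat w x) -> language w.
Proof. by move=> /(language_factor 0 (size w)); rewrite factor_wcat. Qed.

Lemma subshift_algebraP : boolean_algebra_on X U.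
Proof.
by apply: generated_algebraP => _ [w [v [_ _ ->]]] _ [y [-> ]].
Qed.

Lemma subshift_algebra_cyl alpha beta :
  language alpha -> language beta -> U (cyl alpha beta).
Proof. by move=> La Lb M [_]; apply; exists alpha, beta. Qed.

Lemma algebra_set0 : U set0.
Proof.
by have [_ UX UD _] := subshift_algebraP; rewrite -(setDv X); exact: UD.
Qed.

Lemma subshift_algebra_letter a : U (letter_cyl a).
Proof.
rewrite -cyl_letter.
have [La|nLa] := pselect (language [:: a]).
  apply: subshift_algebra_cyl => //.
  by case: La => x [k [Xx _]]; exists x, 0%N.
rewrite (_ : cyl _ _ = set0); first exact: algebra_set0.
apply/seteqP; split=> // x [y [_ Xay _]]; apply: nLa.
exact: (@language_wcat [:: a] y).
Qed.

Lemma subshift_algebra_preshift a B :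
  U B -> U (letter_cyl a `&` shift @^-1` B).
Proof.
have [UX UT UD UI] := subshift_algebraP; have UZ := subshift_algebra_letter.
suff sub : U `<=` [set B | B `<=` X /\ U (letter_cyl a `&` shift @^-1` B)].
  by move=> /sub[].
apply: smallest_sub; first split.
- by move=> C [].
- split=> //=; rewrite (_ : _ `&` _ = letter_cyl a) //.
  apply/setIidPl => x [Xx _]; apply: (@subshift_shift _ S); by exists x.
- move=> C [CX UC]; split; first exact: subDsetl.
  rewrite (_ : _ `&` _ =
    letter_cyl a `&` (X `\` (letter_cyl a `&` shift @^-1` C))).
    by apply: UI => //; exact: UD.
  apply/seteqP; split=> x [[Xx xa] /=].
    by move=> [_ nC]; do !split=> //; move=> [_].
  move=> [_ nC]; do !split=> //; last by move=> Cx; apply: nC.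
  by apply: (@subshift_shift _ S); exists x.
- move=> C D [CX UC] [DX UD']; split; first by move=> x [/CX].
  have := UI _ _ UC UD'; congr U; apply/seteqP.
  by split=> x /=; rewrite /preimage /=; tauto.
- move=> _ [w [v [Lw Lv ->]]]; split; first by move=> x [y [->]].
  have [Lav|nLav] := pselect (language (a :: v)); last first.
    rewrite (_ : _ `&` _ = set0); first exact: algebra_set0.
    apply/seteqP; split=> // x [[Xx xa] [y [xy _ _]]]; apply: nLav.
    by apply: (@language_wcat (a :: v) y); rewrite /= -xy -xa wcons_shift.
  have := subshift_algebra_cyl Lw Lav; congr U; apply/seteqP; split=> x /=.
    move=> [y [-> Xy Xwy]]; split; first by [].
    exists y; split=> //.
    by apply: (@subshift_shift _ S); exists (wcat (a :: v) y).
  move=> [[Xx xa] [y [xy Xvy Xwy]]]; exists y.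
  by rewrite /= -xy -xa wcons_shift.
Qed.

Lemma hatsigma_subproof (xi : subshift_stone) a : sval xi (letter_cyl a) ->
  bultrafilter X U [set B | U B /\ sval xi (letter_cyl a `&` shift @^-1` B)].
Proof.
case: xi => xi /= xiP xia; have UP := subshift_algebraP.
have [UX UT UD UI] := UP.
have /(bultrafilterP _ UP)[[xiU xiX xi0 xiI xiS] xiprime] := xiP.
apply/(bultrafilterP _ UP); split; first split.
- by move=> B [].
- split=> //; apply: (xiS (letter_cyl a)) => //.
    exact: subshift_algebra_preshift.
  by move=> x [Xx xa]; do !split=> //; apply: (@subshift_shift _ S); exists x.
- by move=> [_]; rewrite preimage_set0 setI0.
- move=> B C [UB xB] [UC xC]; split; first exact: UI.
  by rewrite preimage_setI setIIr; exact: xiI.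
- move=> B C [UB xB] UC BC; split=> //; apply: (xiS _ _ xB).
    exact: subshift_algebra_preshift.
  by apply: setIS => x /BC.
- move=> B UB; have [|nB] := xiprime _ (subshift_algebra_preshift a UB).
    by left.
  right; split; first exact: UD.
  apply: (xiS _ _ (xiI _ _ xia nB)).
    by apply: subshift_algebra_preshift; exact: UD.
  move=> x [[Xx xa] [_ nBx]]; do !split=> //; last by move=> Bx; apply: nBx.
  by apply: (@subshift_shift _ S); exists x.
Qed.

Definition hatsigma_dom : set subshift_stone :=
  \bigcup_(a in [set: A]) stone_open (letter_cyl a).

(* equal to xi, a junk value, outside hatsigma_dom; see hatsigmaE *)
Definition hatsigma (xi : subshift_stone) : subshift_stone :=
  match pselect (exists a, sval xi (letter_cyl a)) with
  | left h => exist _ _ (hatsigma_subproof (projT2 (cid h)))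
  | right _ => xi
  end.

Lemma hatsigmaE (xi : subshift_stone) a : stone_open (letter_cyl a) xi ->
  sval (hatsigma xi) =
  [set B | U B /\ sval xi (letter_cyl a `&` shift @^-1` B)].
Proof.
rewrite /stone_open /= => xia; rewrite /hatsigma.
case: pselect => [h|]; last by move=> n; exfalso; apply: n; exists a.
case: (cid h) => b xib /=; suff -> : a = b by [].
case: (svalP xi) => [[_ _ xi0 xiI _] _].
apply: contra_notP xi0 => /= ab; have := xiI _ _ xia xib.
rewrite (_ : letter_cyl a `&` _ = set0) //; apply/seteqP; split=> // x.
by move=> [[_ xa] [_ xb]]; apply: ab; rewrite -xa -xb.
Qed.

End Subshift.

Arguments hatsigma_dom {A} S.
Arguments hatsigma {A} S xi.

Section DeaconuRenault.
Variables (Y : topologicalType) (dom : set Y) (tau : Y -> Y).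

Fixpoint dom_iter (n : nat) : set Y :=
  if n is m.+1 then dom `&` tau @^-1` dom_iter m else setT.

(* for U open, "f restricted to U is a homeomorphism onto its image" *)
Definition homeo_on (f : Y -> Y) (U : set Y) :=
  [/\ {in U &, injective f}, {within U, continuous f} &
      forall W, open W -> W `<=` U ->
        exists2 O, open O & f @` W = O `&` f @` U].

Definition DR_set : set (Y * int * Y) :=
  [set g | exists m n : nat,
    [/\ g.1.2 = m%:Z - n%:Z, dom_iter m g.1.1, dom_iter n g.2 &
        iter m tau g.1.1 = iter n tau g.2]].

Definition DR := {g : Y * int * Y | DR_set g}.

Definition DR_range (g : DR) : Y := (sval g).1.1.
Definition DR_deg (g : DR) : int := (sval g).1.2.
Definition DR_source (g : DR) : Y := (sval g).2.

Definition DR_basic (U : set Y) (m n : nat) (V : set Y) : set DR :=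
  [set g | [/\ U (DR_range g), V (DR_source g), DR_deg g = m%:Z - n%:Z &
               iter m tau (DR_range g) = iter n tau (DR_source g)]].

Definition DR_subbase : set (set DR) :=
  [set W | exists U m n V,
    [/\ [/\ open U, U `<=` dom_iter m & homeo_on (iter m tau) U],
        [/\ open V, V `<=` dom_iter n & homeo_on (iter n tau) V] &
        W = DR_basic U m n V]].

HB.instance Definition _ := gen_eqMixin DR.
HB.instance Definition _ := gen_choiceMixin DR.
HB.instance Definition _ := isSubBaseTopological.Build DR DR_subbase id.

(* [DR_comp g h k] : the product gh is defined and equal to k *)
Definition DR_comp (g h k : DR) :=
  DR_source g = DR_range h /\
  sval k = (DR_range g, DR_deg g + DR_deg h, DR_source h).

Definition orbit (u : Y) : set Y := DR_range @` [set g | DR_source g = u].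

Definition minimal_groupoid := forall u : Y, dense (orbit u).

Definition transitive_groupoid := exists! O : set Y, exists u, O = orbit u.

Definition bisection (U : set DR) :=
  {in U &, injective DR_range} /\ {in U &, injective DR_source}.

Definition compact_open_bisection (U : set DR) :=
  [/\ compact U, open U & bisection U].

End DeaconuRenault.

Definition lin_span (K : pzRingType) (V : lmodType K) (S : set V) : set V :=
  [set v | exists (n : nat) (c : 'I_n -> K) (s : 'I_n -> V),
    (forall i, S (s i)) /\ v = \sum_(i < n) c i *: s i].

Section Steinberg.
Variables (K : fieldType) (Y : topologicalType) (dom : set Y) (tau : Y -> Y).
Local Notation G := (DR dom tau).

Definition steinberg : set (G -> K^o) :=
  lin_span [set f | exists2 U : set G,
    compact_open_bisection U & f = \1_U].

Definition steinberg_deg (m : int) : set (G -> K^o) :=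
  lin_span [set f | exists2 U : set G,
    compact_open_bisection U /\ U `<=` [set g | DR_deg g = m] & f = \1_U].

(* the support of the sum is finite for f and h in the Steinberg algebra *)
Definition convolution (f h : G -> K^o) : G -> K^o :=
  fun g => \sum_(p \in [set p : G * G | DR_comp p.1 p.2 g]) f p.1 * h p.2.

Definition DR_setmul (U V : set G) : set G :=
  [set k | exists g h, [/\ U g, V h & DR_comp g h k]].

Lemma convolution_indic (U V : set G) : bisection U -> bisection V ->
  convolution \1_U \1_V = \1_(DR_setmul U V).
Proof.
move=> [rU _] [_ sV]; apply/funext => k; rewrite /convolution /indic.
have [/set_mem[g [h [Ug Vh ghk]]]|nk] := boolP (k \in DR_setmul U V).
  rewrite -(fsbig_widen [set (g, h)]) ?fsbig_set1 /= ?mem_set ?mulr1 //.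
    by move=> _ ->.
  move=> [g' h'] /= [[_ k'] ne].
  have [/set_mem Ug'|] := boolP (g' \in U); last by rewrite mul0r.
  have [/set_mem Vh'|] := boolP (h' \in V); last by rewrite mulr0.
  exfalso; apply: ne; case: ghk => _; rewrite k' => -[er _ es].
  by congr (_, _); [apply: rU => //; exact: mem_set
                   |apply: sV => //; exact: mem_set].
rewrite fsbig1 // => -[g h] /= ghk.
have [/set_mem Ug|] := boolP (g \in U); last by rewrite mul0r.
have [/set_mem Vh|] := boolP (h \in V); last by rewrite mulr0.
by case/negP: nk; apply/mem_set; exists g, h.
Qed.

End Steinberg.

(* The algebra is a subspace [A] of [V], with multiplication [mul] and, when
   graded, homogeneous components [gr m]. *)
Section JustInfinite.
Variables (K : fieldType) (V : lmodType K) (mul : V -> V -> V).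
Variables (A : set V) (gr : int -> set V).
Implicit Types (I : set V).

Definition ideal I :=
  [/\ I `<=` A, I 0, forall u v, I u -> I v -> I (u + v),
      forall (c : K) u, I u -> I (c *: u) &
      forall a u, A a -> I u -> I (mul a u) /\ I (mul u a)].

Definition fin_dim_quotient I :=
  exists (n : nat) (s : 'I_n -> V), (forall i, A (s i)) /\
    forall a, A a -> exists c : 'I_n -> K, I (a - \sum_(i < n) c i *: s i).

Definition infinite_dim := ~ fin_dim_quotient [set 0].

Definition just_infinite :=
  infinite_dim /\
  forall I, ideal I -> I <> [set 0] -> fin_dim_quotient I.

Definition is_direct_sum (F : int -> set V) I :=
  (forall h : int -> V, finite_set [set m | h m <> 0] ->
     (forall m, F m (h m)) -> I (\sum_(m \in [set: int]) h m)) /\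
  (forall v, I v -> exists! h : int -> V,
     [/\ finite_set [set m | h m <> 0], forall m, F m (h m) &
         v = \sum_(m \in [set: int]) h m]).

Definition graded_ideal I :=
  ideal I /\ is_direct_sum (fun m => gr m `&` I) I.

Definition graded_just_infinite :=
  infinite_dim /\
  forall J, graded_ideal J -> J <> [set 0] -> fin_dim_quotient J.

Definition graded_simple :=
  forall I, graded_ideal I -> I = [set 0] \/ I = A.

End JustInfinite.

Section SubshiftAlgebra.
Variables (K : fieldType) (A : finType) (X : subshift A).

Definition subshift_algebra := @steinberg K _ (hatsigma_dom X) (hatsigma X).

Definition subshift_mul := @convolution K _ (hatsigma_dom X) (hatsigma X).

Definition subshift_deg := @steinberg_deg K _ (hatsigma_dom X) (hatsigma X).

End SubshiftAlgebra.

Arguments subshift_algebra K {A} X _.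
Arguments subshift_mul K {A} X _ _.
Arguments subshift_deg K {A} X _ _.

(* Main.v *)
Require Import Defs.
From mathcomp Require Import all_boot all_order all_algebra.
From mathcomp Require Import all_classical topology.
From mathcomp Require Import numfun finmap zify.

(** The alphabet is finite, so [hatsigma] is defined on the whole Stone space, and
    ultrafilters can be handled like infinite words: they can be prolonged on the left
    by words ([ucat]) and cut ([ucat_prefix_ex]). Every element of the groupoid has the
    form [(v zeta, |v| - |w|, w zeta)] for finite words [v] and [w] and an ultrafilter
    [zeta], and for fixed words the sets [std v w E] obtained by letting [zeta] vary in [O_E]
    are neighbourhood bases ([nbhs_std_ex]). They are compact open bisections, and they
    are closed under intersection and multiplication. Hence the Steinberg algebra is the
    span of their indicators ([algebraE]), and all computations take place with them.

    Graded just infinite implies minimal: if an orbit misses a nonempty open set [O_E], the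
    functions supported over the orbits that meet [O_E] form a nonzero graded ideal, and
    modulo it a point [xi] of the other orbit still carries the elements
    [(xi, m, sigma^m xi)] of infinitely many degrees.

    Minimal implies graded simple: a nonzero graded ideal contains a nonzero homogeneous
    element, which a bisection moves to degree 0. Two different words of the same length
    have disjoint cylinders, so near a unit an element of degree 0 is a multiple of an
    indicator of units ([degree0_local]). The ideal therefore contains the indicator of some
    nonempty [O_B]; minimality spreads it over the unit space, and compactness gives 1.
    Graded simple gives graded just infinite because the algebra is nonzero in infinitely
    many degrees.

    Minimality means that each ultrafilter [xi] can be written [v zeta] with [w zeta] in a given
    nonempty [O_E]. Compactness turns this into finitely many pairs [(v, w)], which is hyper
    cofinality when [E] is an intersection of follower sets. Conversely these intersections
    suffice, because every nonempty set of the Boolean algebra contains a copy [d F] of one of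
    them ([algebra_local]); it is here that [X] has to be closed.

    If [X] is finite, the Stone space is finite and discrete, so a dense orbit is everything
    and minimal is the same as transitive. In a transitive groupoid of this kind the algebra
    behaves like matrices over Laurent polynomials, and dividing by a nonzero element of
    an ideal leaves finitely many degrees ([transitive_just_infinite]). *)

Set Implicit Arguments.
Unset Strict Implicit.
Unset Printing Implicit Defensive.

Import Order.TTheory GRing.Theory Num.Theory.

Local Open Scope classical_set_scope.

(** * The Boolean algebra of a subshift and its ultrafilters *)

Section SubshiftSets.
Variables (A : finType) (S : subshift A).
Local Notation X := (subshift_set S).
Local Notation U := (subshift_algebra_sets S).
Implicit Types (x y z : nat -> A) (v w : seq A) (B C E : set (nat -> A)).

Lemma iter_shift_wcat w y : iter (size w) shift (wcat w y) = y.
Proof. by elim: w => //= a w IHw; rewrite -iterS iterSr /=. Qed.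

Lemma wcat_inj w : injective (wcat w).
Proof. by move=> y z /(congr1 (iter (size w) shift)); rewrite !iter_shift_wcat. Qed.

Lemma wcat_factor x n : wcat (Defs.factor x 0 n) (iter n shift x) = x.
Proof.
elim: n x => [|n IHn] x //; rewrite iterSr /Defs.factor /mkseq /= (iotaDl 1) -map_comp.
by rewrite -[RHS]wcons_shift -[in RHS](IHn (shift x)).
Qed.

Lemma shift_subshift x : X x -> X (shift x).
Proof. by move=> Xx; apply: (@subshift_shift _ S); exists x. Qed.

Lemma iter_shift_subshift n x : X x -> X (iter n shift x).
Proof. by move=> Xx; elim: n => //= n IHn; exact: shift_subshift. Qed.

Lemma wcat_subshift w y : X (wcat w y) -> X y.
Proof. by move=> /(iter_shift_subshift (size w)); rewrite iter_shift_wcat. Qed.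

Lemma algebra_sub B : U B -> B `<=` X.
Proof. by have [UX _ _ _] := subshift_algebraP S; exact: UX. Qed.

Lemma algebra_setT : U X.
Proof. by have [] := subshift_algebraP S. Qed.

Lemma algebra_setC B : U B -> U (X `\` B).
Proof. by have [_ _ UD _] := subshift_algebraP S; exact: UD. Qed.

Lemma algebra_setI B C : U B -> U C -> U (B `&` C).
Proof. by have [_ _ _ UI] := subshift_algebraP S; exact: UI. Qed.

Lemma algebra_setU B C : U B -> U C -> U (B `|` C).
Proof.
move=> UB UC; have := algebra_setC (algebra_setI (algebra_setC UB) (algebra_setC UC)).
congr U; apply/seteqP; split=> x /=; last first.
  by move=> [Bx|Cx]; split; [exact: algebra_sub UB _ Bx|move=> [[_]]|
    exact: algebra_sub UC _ Cx|move=> [_ []]].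
move=> [Xx nx]; have [Bx|nB] := pselect (B x); first by left.
by right; apply: contrapT => nC; apply: nx.
Qed.

Lemma algebra_bigcup (I : eqType) (l : seq I) (F : I -> set (nat -> A)) :
  (forall i, U (F i)) -> U [set x | exists2 i, i \in l & F i x].
Proof.
move=> UF; elim: l => [|i l IHl].
  suff -> : [set x | exists2 i, i \in [::] & F i x] = set0 by exact: algebra_set0.
  by apply/seteqP; split=> // x [].
have := algebra_setU (UF i) IHl; congr U; apply/seteqP; split=> x /=.
  move=> [Fx|[j jl Fx]]; first by exists i; rewrite ?mem_head.
  by exists j => //; rewrite inE jl orbT.
move=> [j]; rewrite inE => /predU1P[->|jl] Fx; first by left.
by right; exists j.
Qed.

Lemma algebra_cyl v w : U (cyl S v w).
Proof.
have [Lv|nLv] := pselect (language S v); last first.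
  rewrite (_ : cyl _ _ _ = set0); first exact: algebra_set0.
  by apply/seteqP; split=> // x [y [_ _ /language_wcat]].
have [Lw|nLw] := pselect (language S w); first exact: subshift_algebra_cyl.
rewrite (_ : cyl _ _ _ = set0); first exact: algebra_set0.
by apply/seteqP; split=> // x [y [_ /language_wcat]].
Qed.

Local Notation prefix_set w := (cyl S [::] w).

Lemma prefix_setP w x :
  prefix_set w x <-> X x /\ x = wcat w (iter (size w) shift x).
Proof.
split=> [[y [-> Xwy _]]|[Xx xE]]; first by rewrite iter_shift_wcat.
by exists (iter (size w) shift x); rewrite -xE; do !split=> //; exact: iter_shift_subshift.
Qed.

Lemma algebra_preimage_shift B : U B -> U (X `&` shift @^-1` B).
Proof.
move=> UB; have := algebra_bigcup (enum A) (fun a => subshift_algebra_preshift a UB).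
congr U; apply/seteqP; split=> x /=; first by move=> [a _ [[]]].
by move=> [Xx Bx]; exists (x 0%N); rewrite ?mem_enum.
Qed.

Lemma algebra_preimage_iter_shift n B : U B -> U (X `&` iter n shift @^-1` B).
Proof.
move=> UB; elim: n => [|n IHn].
  have := UB; congr U; apply/seteqP; split=> x /=; last by case.
  by move=> Bx; split=> //; exact: algebra_sub UB _ Bx.
have := algebra_preimage_shift IHn; congr U; apply/seteqP.
split=> x; rewrite /preimage /= -iterS iterSr; first by move=> [? []].
by move=> [Xx ?]; do 2!split=> //; exact: shift_subshift.
Qed.

(** By induction over the generators, one letter at a time. The points [y] with
    [a y] in [C(u, a v)] form [C(u, v)] cut by the follower set of [a]; for the
    empty word instead of [a v] they form [C(u a, [::])], cut in the same way; and
    a word that starts with another letter gives the empty set. *)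
Lemma algebra_preimage_wcat w B : U B -> U (wcat w @^-1` B).
Proof.
have UF v : U (wcat v @^-1` X).
  have := algebra_cyl v [::]; congr U; apply/seteqP; split=> y /=.
    by move=> [z [-> _]].
  by move=> Xvy; exists y; split=> //; exact: wcat_subshift Xvy.
elim: w B => [|a w IHw] B UB //=.
suff : U (wcons a @^-1` B) by move=> /IHw.
suff sub : U `<=` [set B | B `<=` X /\ U (wcons a @^-1` B)] by have [] := sub _ UB.
apply: smallest_sub; first split.
- by move=> C [].
- by split=> //; exact: (UF [:: a]).
- move=> C [CX UC]; split; first exact: subDsetl.
  have := algebra_setI (UF [:: a]) (algebra_setC UC); congr U; apply/seteqP.
  split=> y; rewrite /preimage /=; first by move=> [? []].
  by move=> [Xy Cy]; do 2!split=> //; exact: (@wcat_subshift [:: a]).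
- move=> C D [CX UC] [DX UD]; split; first by move=> x [/CX].
  exact: algebra_setI.
move=> _ [u [v [_ _ ->]]]; split; first by move=> x [y [->]].
case: v => [|b v].
  have := algebra_setI (UF [:: a]) (algebra_cyl (u ++ [:: a]) [::]); congr U.
  apply/seteqP; split=> y; rewrite /preimage /=.
    move=> [Xay [z [yz _]]]; rewrite wcat_cat => Xu.
    by exists (wcons a y); split=> //; rewrite yz.
  move=> [z [yz Xz]]; have <- : wcons a y = z := yz; move: Xz; rewrite -yz.
  move=> Xay Xu; split=> //; exists y; rewrite wcat_cat; split=> //.
  exact: (@wcat_subshift [:: a]).
have [<-|ab] := eqVneq a b; last first.
  rewrite (_ : _ @^-1` _ = set0); first exact: algebra_set0.
  apply/seteqP; split=> // y.
  rewrite /preimage /= => -[z [/(congr1 (fun x => x 0%N)) /= ba]].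
  by rewrite ba eqxx in ab.
have := algebra_setI (UF [:: a]) (algebra_cyl u v); congr U.
apply/seteqP; split=> y; rewrite /preimage /=.
  by move=> [Xay [z [yE Xvz Xuz]]]; exists z; rewrite /= -yE.
move=> [z [/(congr1 shift) yE Xavz Xuz]].
have {}yE : y = wcat v z by exact: yE.
rewrite yE; split=> //; exists z; split=> //.
exact: (@wcat_subshift [:: a]).
Qed.

Definition cat_set w E := prefix_set w `&` (X `&` iter (size w) shift @^-1` E).

Lemma algebra_cat_set w E : U E -> U (cat_set w E).
Proof.
by move=> UE; apply: algebra_setI; [exact: algebra_cyl|exact: algebra_preimage_iter_shift].
Qed.

Lemma cat_setP w E x : cat_set w E x <-> exists y, [/\ x = wcat w y, X (wcat w y) & E y].
Proof.
split=> [[/prefix_setP[Xx xE] [_ Ex]]|[y [-> Xwy Ey]]].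
  by exists (iter (size w) shift x); rewrite -xE.
by split; [apply/prefix_setP|split=> //]; rewrite /preimage /= iter_shift_wcat.
Qed.

End SubshiftSets.

Notation prefix_set S w := (cyl S [::] w).

Section Ultrafilters.
Variables (A : finType) (S : subshift A).
Local Notation X := (subshift_set S).
Local Notation U := (subshift_algebra_sets S).
Local Notation Y := (subshift_stone S).
Implicit Types (x y : nat -> A) (v w : seq A) (B C E P : set (nat -> A)).
Implicit Types (xi eta zeta : Y).

Lemma stone_algebra xi B : sval xi B -> U B.
Proof. by case: xi => F /= [[FU _ _ _ _] _] /FU. Qed.

Lemma stone_setT xi : sval xi X.
Proof. by case: xi => F /= [[]]. Qed.

Lemma stone_set0 xi : ~ sval xi set0.
Proof. by case: xi => F /= [[]]. Qed.

Lemma stone_setI xi B C : sval xi B -> sval xi C -> sval xi (B `&` C).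
Proof. by case: xi => F /= [[_ _ _ FI _] _]; exact: FI. Qed.

Lemma stone_subset xi B C : sval xi B -> U C -> B `<=` C -> sval xi C.
Proof. by case: xi => F /= [[_ _ _ _ FS] _]; exact: FS. Qed.

Lemma stone_setC xi B : U B -> ~ sval xi B -> sval xi (X `\` B).
Proof.
case: xi => F /= /(bultrafilterP _ (subshift_algebraP S))[_ FP] UB nFB.
by case: (FP _ UB).
Qed.

Lemma stone_nonempty xi B : sval xi B -> exists x, B x.
Proof.
move=> xiB; apply: contrapT => nB; apply: (@stone_set0 xi).
by rewrite -(_ : B = set0)//; apply/seteqP; split=> // x Bx; apply: nB; exists x.
Qed.

Lemma stone_congr xi P B C : sval xi P -> U B -> U C ->
  (forall x, P x -> B x <-> C x) -> sval xi B <-> sval xi C.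
Proof.
move=> xiP UB UC BC; split=> xiB.
  by apply: (stone_subset (stone_setI xiP xiB)) => // x [Px Bx]; apply/BC.
by apply: (stone_subset (stone_setI xiP xiB)) => // x [Px Bx]; apply/BC.
Qed.

(** Primeness of ultrafilters, for finite covers of [X]. *)
Lemma stone_bigcup xi (I : eqType) (l : seq I) (F : I -> set (nat -> A)) :
  (forall i, U (F i)) -> (forall x, X x -> exists2 i, i \in l & F i x) ->
  exists2 i, i \in l & sval xi (F i).
Proof.
move=> UF XF; apply: contrapT => nF.
suff : sval xi (X `\` [set x | exists2 i, i \in l & F i x]).
  by move=> /stone_nonempty[x [/XF]].
apply: stone_setC; first exact: algebra_bigcup.
elim: l {XF} nF => [|i l IHl] nF; first by move=> /stone_nonempty[x []].
have xii : sval xi (X `\` F i).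
  by apply: stone_setC => // xiF; apply: nF; exists i; rewrite ?mem_head.
have {}IHl : ~ sval xi [set x | exists2 i, i \in l & F i x].
  by apply: IHl => -[j jl xiF]; apply: nF; exists j => //; rewrite inE jl orbT.
move=> xil; apply: IHl; apply: (stone_subset (stone_setI xii xil)).
  exact: algebra_bigcup.
move=> x [[_ nFx] [j]]; rewrite inE => /predU1P[->//|jl Fx].
by exists j.
Qed.

(** An inclusion is enough because ultrafilters are maximal. *)
Lemma stone_ext xi eta : sval xi `<=` sval eta -> xi = eta.
Proof.
case: xi eta => [F FP] [G GP] /= FG.
have GF : G = F by case: FP => _; apply=> //; case: GP.
by subst G; congr exist; exact: Prop_irrelevance.
Qed.

Lemma principal_subproof x : X x -> bultrafilter X U [set B | U B /\ B x].
Proof.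
move=> Xx; apply/(bultrafilterP _ (subshift_algebraP S)); split; first split.
- by move=> B [].
- by split=> //; exact: algebra_setT.
- by case.
- by move=> B C [UB Bx] [UC Cx]; split=> //; exact: algebra_setI.
- by move=> B C [UB Bx] UC BC; split=> //; exact: BC.
move=> B UB; have [Bx|nBx] := pselect (B x); [left|right] => //.
by split=> //; exact: algebra_setC.
Qed.

Definition principal x (Xx : X x) : Y := exist _ _ (principal_subproof Xx).

(** The finiteness of the alphabet makes [hatsigma] total: finitely many sets
    [Z_a] cover [X], so every ultrafilter contains one of them. *)
Lemma hatsigma_dom_setT xi : hatsigma_dom S xi.
Proof.
have [|x Xx|a _ xia] := @stone_bigcup xi _ (enum A) (letter_cyl S).
- exact: subshift_algebra_letter.
- by exists (x 0%N); rewrite ?mem_enum.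
by exists a.
Qed.

Lemma dom_iter_setT n xi : dom_iter (hatsigma_dom S) (hatsigma S) n xi.
Proof. by elim: n xi => //= n IHn xi; split; [exact: hatsigma_dom_setT|exact: IHn]. Qed.

(** Being total, [hatsigma] is the pushforward of ultrafilters along the shift, and
    the letter of its definition can be forgotten. *)
Lemma mem_hatsigma xi B :
  sval (hatsigma S xi) B <-> U B /\ sval xi (X `&` shift @^-1` B).
Proof.
have [a _ xia] := hatsigma_dom_setT xi; rewrite (hatsigmaE xia) /=.
split=> -[UB xiB]; split=> //; move: xiB.
all: apply: (iffLR (stone_congr xia _ _ _)) => [||x [Xx xa]]; try exact: subshift_algebra_preshift.
all: try exact: algebra_preimage_shift.
all: by split=> -[].
Qed.

Lemma mem_iter_hatsigma n xi B :
  sval (iter n (hatsigma S) xi) B <-> U B /\ sval xi (X `&` iter n shift @^-1` B).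
Proof.
elim: n xi => [|n IHn] xi.
  split=> [xiB|[UB]]; last by move=> /stone_subset; apply=> // x [].
  by split; [exact: stone_algebra xiB|apply: stone_setI => //; exact: stone_setT].
rewrite iterSr; split.
  move=> /IHn[UB /mem_hatsigma[_ xiB]]; split=> //; move: xiB.
  apply: (iffLR (stone_congr (stone_setT xi) _ _ _)) => [||x Xx].
  - by apply: algebra_preimage_shift; exact: algebra_preimage_iter_shift.
  - exact: algebra_preimage_iter_shift.
  rewrite /preimage /= -iterS iterSr; split=> [[_ []]//|[]] ??.
  by do 2!split=> //; exact: shift_subshift.
move=> [UB xiB]; apply/IHn; split=> //; apply/mem_hatsigma.
split; first exact: algebra_preimage_iter_shift.
move: xiB; apply: (iffLR (stone_congr (stone_setT xi) _ _ _)) => [||x Xx].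
- exact: algebra_preimage_iter_shift.
- by apply: algebra_preimage_shift; exact: algebra_preimage_iter_shift.
rewrite /preimage /= -iterS iterSr; split=> [[] ??|[_ []]//].
by do 2!split=> //; exact: shift_subshift.
Qed.

(** [xi = w zeta]: the pushforward of the ultrafilter [zeta] along [y |-> w y]. It
    is a relation because [w zeta] exists only if [zeta] contains the follower
    set of [w]. *)
Definition ucat w zeta xi := sval xi = [set B | U B /\ sval zeta (wcat w @^-1` B)].

Lemma ucat_ex w zeta : sval zeta (wcat w @^-1` X) -> exists xi, ucat w zeta xi.
Proof.
move=> zw; suff F : bultrafilter X U [set B | U B /\ sval zeta (wcat w @^-1` B)].
  by exists (exist _ _ F).
apply/(bultrafilterP _ (subshift_algebraP S)); split; first split.
- by move=> B [].
- by split=> //; exact: algebra_setT.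
- by rewrite /= preimage_set0 => -[_ /stone_set0].
- move=> B C [UB zB] [UC zC]; split; first exact: algebra_setI.
  by rewrite preimage_setI; exact: stone_setI.
- move=> B C [UB zB] UC BC; split=> //; apply: (stone_subset zB).
    exact: algebra_preimage_wcat.
  by move=> y /BC.
move=> B UB; have [zB|nzB] := pselect (sval zeta (wcat w @^-1` B)); first by left.
right; split; first exact: algebra_setC.
apply: (stone_subset (stone_setI zw (stone_setC (algebra_preimage_wcat w UB) nzB))).
  by apply: algebra_preimage_wcat; exact: algebra_setC.
by move=> y [Xwy [_ nB]].
Qed.

Lemma ucat_mem w zeta xi B : ucat w zeta xi -> U B ->
  sval xi B <-> sval zeta (wcat w @^-1` B).
Proof. by move=> -> UB; split=> [[]|]. Qed.

Lemma ucat_follower w zeta xi : ucat w zeta xi -> sval zeta (wcat w @^-1` X).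
Proof. by move=> /ucat_mem wzx; apply/wzx; [exact: algebra_setT|exact: stone_setT]. Qed.

Lemma ucat_fun w zeta xi eta : ucat w zeta xi -> ucat w zeta eta -> xi = eta.
Proof. by move=> xiE etaE; apply: stone_ext; rewrite xiE etaE. Qed.

(** On the cylinder of [w] the iterated shift undoes the concatenation with [w];
    hence [w zeta] is the only preimage of [zeta] that contains this cylinder. *)
Lemma ucatP w zeta xi : ucat w zeta xi <->
  sval xi (prefix_set S w) /\ iter (size w) (hatsigma S) xi = zeta.
Proof.
split=> [wzx|[xiw <-]].
  split.
    apply/(ucat_mem wzx); first exact: algebra_cyl.
    apply: (stone_subset (ucat_follower wzx)).
      by apply: algebra_preimage_wcat; exact: algebra_cyl.
    by move=> y Xwy; apply/prefix_setP; split=> //; rewrite iter_shift_wcat.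
  symmetry; apply: stone_ext => B zB; have UB := stone_algebra zB.
  apply/mem_iter_hatsigma; split=> //; apply/(ucat_mem wzx).
    exact: algebra_preimage_iter_shift.
  apply: (stone_subset (stone_setI (ucat_follower wzx) zB)).
    by apply: algebra_preimage_wcat; exact: algebra_preimage_iter_shift.
  by move=> y [Xwy By]; split=> //; rewrite /preimage /= iter_shift_wcat.
suff wB B : U B -> sval xi B <-> sval (iter (size w) (hatsigma S) xi) (wcat w @^-1` B).
  apply/seteqP; split=> B /=.
    by move=> xiB; have UB := stone_algebra xiB; split=> //; apply/wB.
  by move=> [UB /wB]; apply.
move=> UB; have UwB := algebra_preimage_wcat w UB.
rewrite (propext (mem_iter_hatsigma _ _ _)).
suff -> : sval xi B <->
    sval xi (X `&` iter (size w) shift @^-1` (wcat w @^-1` B)).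
  by split=> [|[]].
apply: (stone_congr xiw) => //; first exact: algebra_preimage_iter_shift.
move=> x /prefix_setP[Xx xE]; rewrite /preimage /=.
split=> [Bx|[_]]; last by rewrite -xE.
by split=> //; rewrite -xE.
Qed.

Lemma ucat_nil xi : ucat [::] xi xi.
Proof.
apply/ucatP; split=> //; apply: (stone_subset (stone_setT xi)); first exact: algebra_cyl.
by move=> x Xx; apply/prefix_setP.
Qed.

Lemma ucat_cat v w zeta xi :
  ucat (v ++ w) zeta xi <-> exists2 eta, ucat w zeta eta & ucat v eta xi.
Proof.
have pre B : wcat (v ++ w) @^-1` B = wcat w @^-1` (wcat v @^-1` B).
  by apply/seteqP; split=> y; rewrite /preimage /= wcat_cat.
split=> [vwzx|[eta wze vex]]; last first.
  apply/seteqP; split=> B /=; rewrite pre.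
    move=> xiB; have UB := stone_algebra xiB; split=> //.
    by apply/(ucat_mem wze); [exact: algebra_preimage_wcat|apply/(ucat_mem vex)].
  move=> [UB zB]; apply/(ucat_mem vex) => //.
  by apply/(ucat_mem wze) => //; exact: algebra_preimage_wcat.
have [|eta wze] := @ucat_ex w zeta.
  apply: (stone_subset (ucat_follower vwzx)).
    by apply: algebra_preimage_wcat; exact: algebra_setT.
  by move=> y; rewrite /preimage /= wcat_cat => /wcat_subshift.
exists eta => //; apply/seteqP; split=> B /=.
  move=> xiB; have UB := stone_algebra xiB; split=> //.
  apply/(ucat_mem wze); first exact: algebra_preimage_wcat.
  by rewrite -pre; apply/(ucat_mem vwzx).
move=> [UB etaB]; apply/(ucat_mem vwzx) => //; rewrite pre.
by apply/(ucat_mem wze) => //; exact: algebra_preimage_wcat.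
Qed.

Lemma ucat_prefix_ex n xi : exists2 w, size w = n &
  ucat w (iter n (hatsigma S) xi) xi.
Proof.
elim: n xi => [|n IHn] xi; first by exists [::] => //; exact: ucat_nil.
have [w <- wxi] := IHn (hatsigma S xi).
have [a _ xia] := hatsigma_dom_setT xi; exists (a :: w) => //.
apply/(@ucat_cat [:: a]); exists (hatsigma S xi); first by rewrite iterSr.
by apply/ucatP; rewrite cyl_letter.
Qed.

(** Different words of the same length have disjoint cylinders. *)
Lemma ucat_prefix_uniq v w zeta eta xi :
  ucat v zeta xi -> ucat w eta xi -> size v = size w -> v = w.
Proof.
move=> /ucatP[xiv _] /ucatP[xiw _] vw.
have [x [/prefix_setP[_ xv] /prefix_setP[_ xw]]] := stone_nonempty (stone_setI xiv xiw).
by rewrite -(factor_wcat v (iter (size v) shift x)) -xv xw vw factor_wcat.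
Qed.

Lemma ucat_tail v zeta eta xi : ucat v zeta xi -> ucat v eta xi -> zeta = eta.
Proof. by move=> /ucatP[_ <-] /ucatP[_ <-]. Qed.

Lemma mem_cat_set w E xi : U E ->
  sval xi (cat_set S w E) <-> exists2 zeta, ucat w zeta xi & sval zeta E.
Proof.
move=> UE; have [UP Ui] := (@algebra_cyl _ S [::] w, algebra_preimage_iter_shift (size w) UE).
split=> [xiE|[zeta /ucatP[xiw <-] /mem_iter_hatsigma[_ xiE]]]; last exact: stone_setI.
exists (iter (size w) (hatsigma S) xi).
  by apply/ucatP; split=> //; apply: (stone_subset xiE) => //; exact: subIsetl.
apply/mem_iter_hatsigma; split=> //; apply: (stone_subset xiE) => //; exact: subIsetr.
Qed.

Lemma ucat_prefix v w zeta eta xi : ucat v zeta xi -> ucat w eta xi ->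
  (size v <= size w)%N -> exists2 u, w = v ++ u & ucat u eta zeta.
Proof.
move=> vzx wex vw; move: wex; rewrite -{1}(cat_take_drop (size v) w).
move=> /ucat_cat[zeta' dz tx]; have tv : take (size v) w = v.
  by apply: ucat_prefix_uniq tx vzx _; rewrite size_takel.
exists (drop (size v) w); first by rewrite -{1}tv cat_take_drop.
by rewrite tv in tx; rewrite (ucat_tail vzx tx).
Qed.

End Ultrafilters.

(** * The topologies of the Stone space and of the groupoid *)

Section Topology.

(** A neighbourhood of [x] contains a finite intersection of subbasic sets, and [N],
    which stands for a family of basic neighbourhoods of [x], is closed under
    intersection; so it is enough to refine one subbasic set at a time. *)
Lemma subbase_refine (T : choiceType) (D N : set (set T)) (x : T) (W : set T) :
  (exists V, N V) -> (forall V V', N V -> N V' -> N (V `&` V')) ->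
  (forall V, D V -> V x -> exists2 V', N V' & V' `<=` V) ->
  [set \bigcup_(i in D') i | D' in subset^~ (finI_from D id)] W -> W x ->
  exists2 V, N V & V `<=` W.
Proof.
move=> [V0 NV0] NI ND [D' D'sub <-] [V D'V Vx].
have [s sD sV] := D'sub _ D'V.
suff [V' NV' V's] : exists2 V', N V' & forall i, i \in enum_fset s -> V' `<=` i.
  exists V' => // y V'y; exists V => //; rewrite -sV => i si; exact: V's.
have {sD} : forall i, i \in enum_fset s -> D i by move=> i /sD /set_mem.
have {sV} : forall i, i \in enum_fset s -> i x by move=> i si; move: Vx; rewrite -sV; exact.
elim: (enum_fset s) => [|i l IHl] lx lD; first by exists V0.
have lsub j : j \in l -> j \in i :: l by rewrite inE orbC => ->.
have [V1 NV1 V1l] := IHl (fun j jl => lx j (lsub j jl)) (fun j jl => lD j (lsub j jl)).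
have [|V2 NV2 V2i] := ND i (lD _ (mem_head _ _)); first by apply: lx; exact: mem_head.
exists (V1 `&` V2); first exact: NI.
move=> j; rewrite inE => /predU1P[->|/V1l jl]; first by apply: subset_trans V2i => y [].
by apply: subset_trans jl => y [].
Qed.

(** Otherwise the sets [K `\` V], for [V] in [P], would generate a proper filter, and
    a cluster point of it could not lie in the interior of any [V]. It
    replaces the extraction of finite subcovers. *)
Lemma compact_union_ind (T : topologicalType) (K : set T) (P : set T -> Prop) :
  compact K -> P set0 -> (forall V W, P V -> P W -> P (V `|` W)) ->
  (forall x, K x -> exists2 V, P V & nbhs x V) -> exists2 V, P V & K `<=` V.
Proof.
move=> cK P0 PU PK; apply: contrapT => nP.
pose F := filter_from P (fun V => K `\` V).
have FF : ProperFilter F.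
  apply: filter_from_proper.
    apply: filter_from_filter; first by exists set0.
    move=> V W PV PW; exists (V `|` W); first exact: PU.
    by move=> x [Kx nVW]; split; split=> // ?; apply: nVW; [left|right].
  move=> V PV; apply: contrapT => nx; apply: nP; exists V => // x Kx.
  by apply: contrapT => nVx; apply: nx; exists x.
have [|x [Kx clx]] := cK F FF; first by exists set0 => // x [].
have [V PV xV] := PK x Kx.
have [|y [[_ nVy]]] := clx (K `\` V) V _ xV; first by exists V.
exact.
Qed.

End Topology.

Section StoneSpace.
Variables (A : finType) (S : subshift A).
Local Notation X := (subshift_set S).
Local Notation U := (subshift_algebra_sets S).
Local Notation Y := (subshift_stone S).
Local Notation basic := (@stone_open _ X U).
Implicit Types (x y : nat -> A) (v w : seq A) (B C E P : set (nat -> A)).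
Implicit Types (xi eta zeta : Y).

Lemma open_basic B : U B -> open (basic B).
Proof.
move=> UB; exists [set basic B]; last by rewrite bigcup_set1.
move=> _ ->; exists [fset (basic B)]%fset; last first.
  apply/seteqP; split=> y /=; first by apply; rewrite /= inE.
  by move=> yB i; rewrite /= inE => /eqP ->.
by move=> i; rewrite inE => /eqP ->; apply/mem_set; exists B.
Qed.

Lemma nbhs_basic xi B : sval xi B -> nbhs xi (basic B).
Proof.
move=> xiB; apply: open_nbhs_nbhs; split=> //.
by apply: open_basic; exact: stone_algebra xiB.
Qed.

Lemma nbhs_basic_ex xi (W : set Y) : nbhs xi W ->
  exists2 B, sval xi B & basic B `<=` W.
Proof.
rewrite nbhsE => -[V [oV Vxi] VW].
have [|||_ [B xiB <-] BV] := @subbase_refine _ (@stone_open _ X U @` U)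
    [set basic B | B in sval xi] xi V _ _ _ oV Vxi.
- by exists (basic X); exists X => //; exact: stone_setT.
- move=> _ _ [B xiB <-] [C xiC <-]; exists (B `&` C); first exact: stone_setI.
  apply/seteqP; split=> eta /=; last by move=> [? ?]; exact: stone_setI.
  move=> eBC; have [UB UC] := (stone_algebra xiB, stone_algebra xiC).
  by split; apply: (stone_subset eBC).
- by move=> _ [B UB <-] /= xiB; exists (basic B) => //; exists B.
by exists B => //; exact: subset_trans VW.
Qed.

(** An ultrafilter [F] of sets of ultrafilters converges to the collection of all
    [B] such that [F] contains [O_B]. *)
Lemma stone_compact : compact [set: Y].
Proof.
rewrite compact_ultra => F FF _.
have xiP : bultrafilter X U [set B | U B /\ F (basic B)].
  apply/(bultrafilterP _ (subshift_algebraP S)); split; first split.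
  - by move=> B [].
  - split; first exact: algebra_setT.
    by apply: filterS filterT => xi _; exact: stone_setT.
  - by move=> [_ /filter_ex[xi /stone_set0]].
  - move=> B C [UB FB] [UC FC]; split; first exact: algebra_setI.
    by apply: filterS (filterI FB FC) => xi [??]; exact: stone_setI.
  - by move=> B C [UB FB] UC BC; split=> //; apply: filterS FB => xi xiB; exact: stone_subset BC.
  move=> B UB; have [FB|FB] := in_ultra_setVsetC (basic B) FF; [left|right] => //.
  split; first exact: algebra_setC.
  by apply: filterS FB => xi nB; exact: stone_setC.
exists (exist _ _ xiP); split=> // W /nbhs_basic_ex[B [_ FB] BW].
exact: filterS FB.
Qed.

(** Compactness of the Stone space, expressed inside the Boolean algebra. *)
Lemma stone_compact_ind (P : set (nat -> A) -> Prop) :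
  P set0 -> (forall B C, U B -> U C -> P B -> P C -> P (B `|` C)) ->
  (forall xi, exists2 B, P B & sval xi B) -> P X.
Proof.
move=> P0 PU PY.
have [||xi _|_ [B [UB PB] <-] BY] := @compact_union_ind Y setT
    [set basic B | B in [set B | U B /\ P B]] stone_compact.
- exists set0; first by split=> //; exact: algebra_set0.
  by apply/seteqP; split=> // xi /stone_set0.
- move=> _ _ [B [UB PB] <-] [C [UC PC] <-]; have UBC := algebra_setU UB UC.
  exists (B `|` C); first by split=> //; exact: PU.
  apply/seteqP; split=> xi /=.
    move=> xiBC; have [xiB|nB] := pselect (sval xi B); [by left|right].
    apply: (stone_subset (stone_setI xiBC (stone_setC UB nB))) => //.
    by move=> x [[Bx|Cx] [_ nBx]].
  by move=> [/stone_subset|/stone_subset]; apply=> //.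
- have [B PB xiB] := PY xi; exists (basic B); last exact: nbhs_basic.
  by exists B => //; split=> //; exact: stone_algebra xiB.
suff <- : B = X by [].
apply/seteqP; split; first exact: algebra_sub.
by move=> x Xx; have [] := BY (principal Xx).
Qed.

(** The inverse is [zeta |-> w zeta]. The image is open because [w zeta] lies in [O_B]
    exactly if [zeta] lies in [O_B'], with [B'] the preimage of [B] under [w]. *)
Lemma homeo_on_hatsigma w (W : set Y) : W `<=` basic (prefix_set S w) ->
  homeo_on (iter (size w) (hatsigma S)) W.
Proof.
move=> Ww; split.
- move=> xi eta /set_mem/Ww xiw /set_mem/Ww etaw e.
  by apply: (@ucat_fun _ _ w (iter (size w) (hatsigma S) xi)); apply/ucatP.
- move=> xi; apply: continuous_subspaceT => {}xi V /nbhs_basic_ex[B].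
  move=> /mem_iter_hatsigma[UB xiB] BV.
  apply: filterS (nbhs_basic xiB) => eta etaB; apply: BV.
  by apply/mem_iter_hatsigma.
move=> V oV VW; exists (iter (size w) (hatsigma S) @` V); last first.
  apply/seteqP; split; last by move=> ? [].
  by move=> _ [xi Vxi <-]; split; exists xi => //; exact: VW.
rewrite openE => _ [xi Vxi <-] /=.
have wxi : ucat w (iter (size w) (hatsigma S) xi) xi by apply/ucatP; split=> //; exact/Ww/VW.
have [B xiB BV] := nbhs_basic_ex (open_nbhs_nbhs (conj oV Vxi)).
have UB := stone_algebra xiB; have zB := (iffLR (ucat_mem wxi UB) xiB).
apply: filterS (nbhs_basic zB) => zeta zetaB.
have [|eta weta] := @ucat_ex _ _ w zeta.
  apply: (stone_subset zetaB); first by apply: algebra_preimage_wcat; exact: algebra_setT.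
  by move=> y By; exact: algebra_sub UB _ By.
exists eta; first by apply: BV; exact/(ucat_mem weta).
by have /ucatP[] := weta.
Qed.

End StoneSpace.

Section Groupoid.
Variables (A : finType) (S : subshift A).
Local Notation X := (subshift_set S).
Local Notation U := (subshift_algebra_sets S).
Local Notation Y := (subshift_stone S).
Local Notation basic := (@stone_open _ X U).
Local Notation G := (DR (hatsigma_dom S) (hatsigma S)).
Implicit Types (x y : nat -> A) (u v w : seq A) (B C E P : set (nat -> A)).
Implicit Types (xi eta zeta theta : Y) (g h k : G).
Local Notation sh := (hatsigma S).

Lemma DR_ext g h : DR_range g = DR_range h -> DR_deg g = DR_deg h ->
  DR_source g = DR_source h -> g = h.
Proof.
case: g h => [[[x k] y] gP] [[[x' k'] y'] hP]; rewrite /DR_range /DR_deg /DR_source /=.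
by move=> ???; subst; congr exist; exact: Prop_irrelevance.
Qed.

Lemma DR_ex xi eta m n : iter m sh xi = iter n sh eta ->
  exists g, [/\ DR_range g = xi, DR_deg g = (m%:Z - n%:Z)%R & DR_source g = eta].
Proof.
move=> e; suff gP : DR_set (hatsigma_dom S) sh (xi, m%:Z - n%:Z, eta)%R.
  by exists (exist _ _ gP).
by exists m, n; split=> //=; exact: dom_iter_setT.
Qed.

Lemma DR_P g : exists m n, DR_deg g = (m%:Z - n%:Z)%R /\
  iter m sh (DR_range g) = iter n sh (DR_source g).
Proof. by have [m [n [gd _ _ e]]] := svalP g; exists m, n. Qed.

(** The set of all [(v zeta, |v| - |w|, w zeta)] with [zeta] in [O_E]. Its indicator is
    the element usually written [s_v p_E s_w^*]; these sets are called standard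
    bisections below. *)
Definition std v w E : set G := [set g | exists zeta,
  [/\ sval zeta E, ucat v zeta (DR_range g), ucat w zeta (DR_source g) &
      DR_deg g = ((size v)%:Z - (size w)%:Z)%R]].

Lemma std_ex_at g : exists v w zeta,
  [/\ ucat v zeta (DR_range g), ucat w zeta (DR_source g) &
      DR_deg g = ((size v)%:Z - (size w)%:Z)%R].
Proof.
have [m [n [gd e]]] := DR_P g.
have [v vm vr] := ucat_prefix_ex m (DR_range g).
have [w wn ws] := ucat_prefix_ex n (DR_source g).
by exists v, w, (iter m sh (DR_range g)); rewrite vm wn; split=> //; rewrite e.
Qed.

Lemma std_elem v w zeta : sval zeta (wcat v @^-1` X) -> sval zeta (wcat w @^-1` X) ->
  exists g, [/\ ucat v zeta (DR_range g), ucat w zeta (DR_source g) &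
      DR_deg g = ((size v)%:Z - (size w)%:Z)%R].
Proof.
move=> /ucat_ex[xi vxi] /ucat_ex[eta weta].
have [|g [gr gd gs]] := @DR_ex xi eta (size v) (size w).
  by have /ucatP[_ ->] := vxi; have /ucatP[_ ->] := weta.
by exists g; rewrite gr gs.
Qed.

Lemma std_range_inj v w E g h : std v w E g -> std v w E h ->
  DR_range g = DR_range h -> g = h.
Proof.
move=> [z [_ vz wz gd]] [z' [_ vz' wz' hd]] e; apply: DR_ext => //.
  by rewrite gd hd.
rewrite e in vz; have zz := ucat_tail vz vz'; subst z'.
exact: ucat_fun wz wz'.
Qed.

Lemma std_source_inj v w E g h : std v w E g -> std v w E h ->
  DR_source g = DR_source h -> g = h.
Proof.
move=> [z [_ vz wz gd]] [z' [_ vz' wz' hd]] e; apply: DR_ext => //.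
  2: by rewrite gd hd.
rewrite e in wz; have zz := ucat_tail wz wz'; subst z'.
exact: ucat_fun vz vz'.
Qed.

Lemma std_bisection v w E : bisection (std v w E).
Proof.
by split=> g h /set_mem gE /set_mem hE; [exact: std_range_inj gE hE|exact: std_source_inj gE hE].
Qed.

Lemma open_std v w E : U E -> open (std v w E).
Proof.
move=> UE; pose V u := basic (cat_set S u E).
have oV u : open (V u) by apply: open_basic; exact: algebra_cat_set.
have VP u xi : V u xi <-> sval xi (prefix_set S u) /\ sval (iter (size u) sh xi) E.
  split=> [/mem_cat_set[//|z /ucatP[? <-]]//|[xiu zE]].
  by apply/mem_cat_set => //; exists (iter (size u) sh xi) => //; apply/ucatP.
have hV u : [/\ open (V u), V u `<=` dom_iter (hatsigma_dom S) sh (size u) &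
    homeo_on (iter (size u) sh) (V u)].
  split=> //; first by move=> xi _; exact: dom_iter_setT.
  by apply: homeo_on_hatsigma => xi /VP[].
pose D := @DR_basic _ (hatsigma_dom S) sh (V v) (size v) (size w) (V w).
suff -> : std v w E = D.
  exists [set D]; last by rewrite bigcup_set1.
  move=> _ ->; exists [fset D]%fset; last first.
    apply/seteqP; split=> y /=; first by apply; rewrite /= inE.
    by move=> yB i; rewrite /= inE => /eqP ->.
  move=> i; rewrite inE => /eqP ->; apply/mem_set.
  by exists (V v), (size v), (size w), (V w).
apply/seteqP; split=> g.
  move=> [z [zE /ucatP[rv rz] /ucatP[sw sz] gd]]; split=> //.
  - by apply/VP; rewrite rz.
  - by apply/VP; rewrite sz.
  by rewrite rz sz.
move=> [/VP[rv rE] /VP[sw _] gd e]; exists (iter (size v) sh (DR_range g)).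
by split=> //; apply/ucatP.
Qed.

(** Keeping the words fixed is possible because [(v zeta, |v| - |w|, w zeta)] depends
    continuously on [zeta]. The set [std v w E] is therefore a copy of a clopen part of
    the Stone space, which gives its compactness below. *)
Lemma nbhs_std_ex g v w zeta (W : set G) :
  ucat v zeta (DR_range g) -> ucat w zeta (DR_source g) ->
  DR_deg g = ((size v)%:Z - (size w)%:Z)%R -> nbhs g W ->
  exists2 E, sval zeta E & std v w E `<=` W.
Proof.
move=> vz wz gd; rewrite nbhsE => -[V [oV Vg] VW].
have [|||_ [E zE <-] EV] := @subbase_refine _ (@DR_subbase _ (hatsigma_dom S) sh)
    [set std v w E | E in sval zeta] g V _ _ _ oV Vg.
- by exists (std v w X); exists X => //; exact: stone_setT.
- move=> _ _ [E zE <-] [F zF <-]; exists (E `&` F); first exact: stone_setI.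
  have [UE UF] := (stone_algebra zE, stone_algebra zF).
  apply/seteqP; split=> h.
    by move=> [z [zEF vz' wz' hd]]; split; exists z; split=> //; apply: (stone_subset zEF).
  move=> [[z [zE' vz' wz' hd]] [z' [zF' vz'' _ _]]]; exists z; split=> //.
  by apply: stone_setI => //; rewrite (ucat_tail vz' vz'').
- move=> _ [V1 [m [n [V2 [[oV1 _ _] [oV2 _ _] ->]]]]] [gV1 gV2 gmn gE].
  have [B1 rB1 B1V1] := nbhs_basic_ex (open_nbhs_nbhs (conj oV1 gV1)).
  have [B2 sB2 B2V2] := nbhs_basic_ex (open_nbhs_nbhs (conj oV2 gV2)).
  have [UB1 UB2] := (stone_algebra rB1, stone_algebra sB2).
  exists (std v w (wcat v @^-1` B1 `&` wcat w @^-1` B2)).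
    exists (wcat v @^-1` B1 `&` wcat w @^-1` B2) => //.
    by apply: stone_setI; [exact/(ucat_mem vz)|exact/(ucat_mem wz)].
  move=> h [z [zB vz' wz' hd]].
  have Uv := algebra_preimage_wcat v UB1; have Uw := algebra_preimage_wcat w UB2.
  split.
  - by apply/B1V1/(ucat_mem vz') => //; apply: (stone_subset zB) => //; exact: subIsetl.
  - by apply/B2V2/(ucat_mem wz') => //; apply: (stone_subset zB) => //; exact: subIsetr.
  - by rewrite hd -gd gmn.
  (* If m <= |v|, the letters of v beyond m and those of w beyond n agree, because
     sigma^m and sigma^n agree at the ends of g; hence sigma^m (v z) = sigma^n (w z)
     for all z. Otherwise both sides are iterates of sigma at the same z. *)
  have [mv|vm] := leqP m (size v).
    have nw : (n <= size w)%N by rewrite gd in gmn; lia.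
    move: (vz) (wz) (vz') (wz').
    rewrite -(cat_take_drop m v) -(cat_take_drop n w).
    move=> /ucat_cat[e1 d1 t1] /ucat_cat[e2 d2 t2] /ucat_cat[e3 d3 t3] /ucat_cat[e4 d4 t4].
    have st : size (take m v) = m by rewrite size_takel.
    have st' : size (take n w) = n by rewrite size_takel.
    have /ucatP[_ r1] := t1; have /ucatP[_ r2] := t2.
    have /ucatP[_ r3] := t3; have /ucatP[_ r4] := t4.
    rewrite st in r1 r3; rewrite st' in r2 r4.
    have e12 : e1 = e2 by rewrite -r1 -r2.
    have dd : drop m v = drop n w.
      rewrite e12 in d1; apply: ucat_prefix_uniq d1 d2 _.
      by rewrite !size_drop; rewrite gd in gmn; lia.
    by rewrite r3 r4; rewrite dd in d3; exact: ucat_fun d3 d4.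
  have -> : m = ((m - size v) + size v)%N by lia.
  have -> : n = ((m - size v) + size w)%N by rewrite gd in gmn; lia.
  have /ucatP[_ r1] := vz'; have /ucatP[_ r2] := wz'.
  by rewrite !iterD r1 r2.
by exists E => //; exact: subset_trans VW.
Qed.

Lemma compact_std v w E : U E -> compact (std v w E).
Proof.
move=> UE F FF FE.
pose f (g : G) := iter (size v) sh (DR_range g).
(* Both v zeta and w zeta exist for zeta in E'. *)
pose E' := E `&` (wcat v @^-1` X `&` wcat w @^-1` X).
have UE' : U E'.
  by do 2!apply: algebra_setI => //; apply: algebra_preimage_wcat; exact: algebra_setT.
have stdf g : std v w E g -> sval (f g) E'.
  move=> [z [zE vz wz _]]; have /ucatP[_ fz] := vz; rewrite /f fz.
  by apply: stone_setI => //; apply: stone_setI; [exact: ucat_follower vz|exact: ucat_follower wz].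
have [zeta [_ clz]] := @stone_compact _ S (f @ F) _ filterT.
have zE' : sval zeta E'.
  apply: contrapT => nE; have zC := stone_setC UE' nE.
  have FfE : F (f @^-1` basic E') by apply: filterS FE => g; exact: stdf.
  have [eta [eE eC]] := clz (basic E') _ FfE (nbhs_basic zC).
  by have [x [? []]] := stone_nonempty (stone_setI eE eC).
have zE : sval zeta E by apply: (stone_subset zE') => //; exact: subIsetl.
have [||g [vz wz gd]] := @std_elem v w zeta.
- apply: (stone_subset zE'); first by apply: algebra_preimage_wcat; exact: algebra_setT.
  by move=> x [_ []].
- apply: (stone_subset zE'); first by apply: algebra_preimage_wcat; exact: algebra_setT.
  by move=> x [_ []].
exists g; split; first by exists zeta.
move=> V W FV gW; have [B zB BW] := nbhs_std_ex vz wz gd gW.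
have FfV : F (f @^-1` (f @` (V `&` std v w E))).
  by apply: filterS (filterI FV FE) => h ?; exists h.
have [_ [[h [Vh hE] <-] fB]] := clz (f @` (V `&` std v w E)) _ FfV (nbhs_basic zB).
exists h; split=> //; apply: BW; have [z [_ vz' wz' hd]] := hE.
by exists z; split=> //; have /ucatP[_ <-] := vz'.
Qed.

Lemma std_cob v w E : U E -> compact_open_bisection (std v w E).
Proof. by move=> UE; split; [exact: compact_std|exact: open_std|exact: std_bisection]. Qed.

End Groupoid.

Local Open Scope ring_scope.

(** * The Steinberg algebra as a span of standard bisections *)

Section LinearSpan.
Variables (K : pzRingType) (V : lmodType K) (T : set V).

Lemma lin_span_ind (P : V -> Prop) : P 0 ->
  (forall u v, P u -> P v -> P (u + v)) -> (forall (c : K) u, P u -> P (c *: u)) ->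
  (forall s, T s -> P s) -> forall v, lin_span T v -> P v.
Proof.
move=> P0 PD PZ PT _ [n [c [s [sT ->]]]].
by apply: big_ind => // i _; apply: PZ; exact: PT.
Qed.

Lemma lin_span0 : lin_span T 0.
Proof. by exists 0%N, (fun=> 0), (fun=> 0); split=> [[]//|]; rewrite big_ord0. Qed.

Lemma lin_span_gen s : T s -> lin_span T s.
Proof.
by move=> Ts; exists 1%N, (fun=> 1), (fun=> s); rewrite big_ord1 scale1r.
Qed.

Lemma lin_spanZ c v : lin_span T v -> lin_span T (c *: v).
Proof.
move=> [n [d [s [sT ->]]]]; exists n, (fun i => c * d i), s; split=> //.
by rewrite scaler_sumr; apply: eq_bigr => i _; rewrite scalerA.
Qed.

Lemma lin_spanD u v : lin_span T u -> lin_span T v -> lin_span T (u + v).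
Proof.
move=> [n [c [s [sT ->]]]] [m [d [t [tT ->]]]].
exists (n + m)%N.
exists (fun i => match fintype.split i with inl j => c j | inr j => d j end).
exists (fun i => match fintype.split i with inl j => s j | inr j => t j end).
split=> [i|]; first by case: (fintype.split i).
rewrite big_split_ord; congr (_ + _); apply: eq_bigr => i _.
  by rewrite -[lshift _ _]/(unsplit (inl i)) unsplitK.
by rewrite -[rshift _ _]/(unsplit (inr i)) unsplitK.
Qed.

End LinearSpan.

Lemma lin_span_sub (K : pzRingType) (V : lmodType K) (T T' : set V) :
  T `<=` lin_span T' -> lin_span T `<=` lin_span T'.
Proof.
move=> TT' v; apply: lin_span_ind => //; first exact: lin_span0.
- by move=> u w; exact: lin_spanD.
- by move=> c u; exact: lin_spanZ.
Qed.

Section Groupoid.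
Variables (A : finType) (S : subshift A).
Local Notation X := (subshift_set S).
Local Notation U := (subshift_algebra_sets S).
Local Notation Y := (subshift_stone S).
Local Notation G := (DR (hatsigma_dom S) (hatsigma S)).
Implicit Types (x y : nat -> A) (u v w : seq A) (B C E P : set (nat -> A)).
Implicit Types (xi eta zeta theta : Y) (d g h k p q : G).
Local Notation sh := (hatsigma S).

Lemma DR_comp_ex g h : DR_source g = DR_range h -> exists k, DR_comp g h k.
Proof.
move=> gh; have [m [n [gd ge]]] := DR_P g; have [m' [n' [hd he]]] := DR_P h.
have [|k [kr kd ks]] := @DR_ex _ S (DR_range g) (DR_source h) (m' + m) (n + n').
  by rewrite iterD ge gh -iterD addnC iterD he -iterD.
exists k; split=> //; rewrite -kr -ks gd hd.
rewrite [LHS](surjective_pairing (sval k)) [X in (X, _)]surjective_pairing.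
by congr (_, _, _); rewrite -[LHS]/(DR_deg k) kd; lia.
Qed.

Lemma DR_compP g h k : DR_comp g h k -> [/\ DR_source g = DR_range h,
  DR_range k = DR_range g, DR_deg k = DR_deg g + DR_deg h &
  DR_source k = DR_source h].
Proof. by move=> [gh e]; rewrite /DR_range /DR_deg /DR_source e. Qed.

Lemma DR_comp_intro g h k : DR_source g = DR_range h -> DR_range k = DR_range g ->
  DR_deg k = DR_deg g + DR_deg h -> DR_source k = DR_source h -> DR_comp g h k.
Proof.
move=> gh kr kd ks; have [k' kk'] := DR_comp_ex gh.
have [_ kr' kd' ks'] := DR_compP kk'.
by rewrite (_ : k = k')//; apply: DR_ext; rewrite ?kr' ?kd' ?ks'.
Qed.

Lemma DR_inv_ex g : exists h, [/\ DR_range h = DR_source g,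
  DR_deg h = - DR_deg g & DR_source h = DR_range g].
Proof.
have [m [n [gd ge]]] := DR_P g.
have [h [hr hd hs]] := @DR_ex _ S _ _ n m (esym ge).
by exists h; split=> //; rewrite hd gd opprB.
Qed.

Lemma DR_ldiv d g : DR_range d = DR_range g -> exists k, DR_comp d k g.
Proof.
move=> dg; have [d' [dr dd ds]] := DR_inv_ex d.
have [|k /DR_compP[_ kr kd ks]] := @DR_comp_ex d' g; first by rewrite ds.
by exists k; apply: DR_comp_intro; rewrite ?kr ?kd ?ks ?dd//; lia.
Qed.

Lemma DR_comp_injr d g k k' : DR_comp d k g -> DR_comp d k' g -> k = k'.
Proof.
move=> /DR_compP[dk _ gd gs] /DR_compP[dk' _ gd' gs']; apply: DR_ext.
- by rewrite -dk.
- by apply: (@addrI _ (DR_deg d)); rewrite -gd.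
- by rewrite -gs.
Qed.

Lemma DR_comp_injl d g k k' : DR_comp k d g -> DR_comp k' d g -> k = k'.
Proof.
move=> /DR_compP[dk gr gd _] /DR_compP[dk' gr' gd' _]; apply: DR_ext.
- by rewrite -gr.
- by apply: (@addIr _ (DR_deg d)); rewrite -gd.
- by rewrite dk.
Qed.

Definition is_std (D : set G) := exists v w E, U E /\ D = std v w E.

Lemma is_std0 : is_std set0.
Proof.
exists [::], [::], set0; split; first exact: algebra_set0.
by apply/seteqP; split=> // g [z [/stone_set0]].
Qed.

(** If the two sets meet, then the longer pair of words is [(v u, w u)] for the shorter
    pair [(v, w)] and a single word [u], which is read off from a common point. *)
Lemma is_std_setI D D' : is_std D -> is_std D' -> is_std (D `&` D').
Proof.
suff H v w E v' w' E' : U E -> U E' -> (size v <= size v')%N ->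
    is_std (std v w E `&` std v' w' E').
  move=> [v [w [E [UE ->]]]] [v' [w' [E' [UE' ->]]]].
  have [vv|/ltnW vv] := leqP (size v) (size v'); first exact: H.
  by rewrite setIC; exact: H.
move=> UE UE' vv'.
have [[g [gD gD']]|nD] := pselect (exists g, (std v w E `&` std v' w' E') g); last first.
  rewrite (_ : _ `&` _ = set0); first exact: is_std0.
  by apply/seteqP; split=> // g gD; apply: nD; exists g.
have [z [_ vz wz gd]] := gD; have [z' [_ vz' wz' gd']] := gD'.
have ww' : (size w <= size w')%N by rewrite gd in gd'; lia.
have [u vE uz] := ucat_prefix vz vz' vv'.
have [u' wE uz'] := ucat_prefix wz wz' ww'.
have uu' : u' = u.
  apply: ucat_prefix_uniq uz' uz _.
  move: gd'; rewrite gd vE wE !size_cat; lia.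
subst u' v' w'.
exists (v ++ u), (w ++ u), (E' `&` wcat u @^-1` E); split.
  by apply: algebra_setI => //; exact: algebra_preimage_wcat.
apply/seteqP; split=> h.
  move=> [[t [tE vt wt hd]] [t' [tE' vt' wt' hd']]]; exists t'; split=> //.
  apply: stone_setI => //; apply/(@ucat_mem _ _ u _ t) => //.
  have /ucat_cat[t'' ut'' vt''] := vt'.
  by rewrite (ucat_tail vt vt'').
move=> [t' [t'E /ucat_cat[s us vs] /ucat_cat[s' us' ws'] hd]].
have ss : s' = s by exact: ucat_fun us' us.
subst s'; split.
  exists s; split=> //; last by rewrite hd !size_cat; lia.
  apply/(ucat_mem us) => //; apply: (stone_subset t'E) => //.
  exact: algebra_preimage_wcat.
exists t'; split=> //; [|by apply/ucat_cat; exists s..].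
by apply: (stone_subset t'E).
Qed.

Definition DR_setinv (D : set G) : set G :=
  [set g | exists2 d, D d & [/\ DR_range g = DR_source d,
    DR_deg g = - DR_deg d & DR_source g = DR_range d]].

Lemma setinv_std v w E : DR_setinv (std v w E) = std w v E.
Proof.
apply/seteqP; split=> g.
  move=> [d [z [zE vz wz dd]] [gr gd gs]]; exists z; split; rewrite ?gr ?gs//.
  by rewrite gd dd opprB.
move=> [z [zE wz vz gd]]; have [d [dr dd ds]] := DR_inv_ex g.
exists d; last by rewrite dr dd ds opprK.
by exists z; rewrite dr ds dd gd opprB.
Qed.

Lemma is_std_inv D : is_std (DR_setinv D) -> is_std D.
Proof.
move=> [v [w [E [UE e]]]]; exists w, v, E; split=> //; rewrite -setinv_std -e.
apply/seteqP; split=> g.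
  move=> Dg; have [d [dr dd ds]] := DR_inv_ex g.
  by exists d; [exists g|rewrite dr dd ds opprK].
move=> [d [h Dh [dr dd ds]] [gr gd gs]].
rewrite (_ : g = h)//; apply: DR_ext; rewrite ?gr ?gs ?gd ?dd ?opprK//.
Qed.

Lemma setinv_setmul D D' : DR_setinv (DR_setmul D D') =
  DR_setmul (DR_setinv D') (DR_setinv D).
Proof.
apply/seteqP; split=> g.
  move=> [h [d [d' [Dd D'd' /DR_compP[dd' hr hd hs]]]] [gr gd gs]].
  have [e [er ed es]] := DR_inv_ex d; have [e' [er' ed' es']] := DR_inv_ex d'.
  exists e', e; split; [by exists d'|by exists d|].
  by apply: DR_comp_intro; rewrite ?er ?es ?er' ?es' ?ed ?ed' ?gr ?gd ?gs ?hr ?hs ?hd//; lia.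
move=> [e' [e [[d' D'd' [er' ed' es']] [d Dd [er ed es]] /DR_compP[ee gr gd gs]]]].
have [|h hh] := @DR_comp_ex d d'; first by rewrite -er -es'.
exists h; first by exists d, d'.
have /DR_compP[_ hr hd hs] := hh.
by split; rewrite ?gr ?gs ?gd ?hr ?hs ?hd ?ed ?ed'//; lia.
Qed.

(** This is [s_v p_E s_w^* s_(w u) p_E' s_w'^* = s_(v u) p_E'' s_w'^*], where [E'']
    consists of the points of [E'] that [w u] can precede and that [u] takes into [E]. The
    case in which the second of the two inner words is the shorter follows by taking
    inverses. *)
Lemma is_std_setmul D D' : is_std D -> is_std D' -> is_std (DR_setmul D D').
Proof.
suff H v w E v' w' E' : U E -> U E' -> (size w <= size v')%N ->
    is_std (DR_setmul (std v w E) (std v' w' E')).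
  move=> [v [w [E [UE ->]]]] [v' [w' [E' [UE' ->]]]].
  have [wv|/ltnW wv] := leqP (size w) (size v'); first exact: H.
  by apply: is_std_inv; rewrite setinv_setmul !setinv_std; exact: H.
move=> UE UE' wv'.
have [[_ [d [d' [dD d'D' /DR_compP[dd' _ _ _]]]]]|nD] :=
    pselect (exists g, DR_setmul (std v w E) (std v' w' E') g); last first.
  rewrite (_ : DR_setmul _ _ = set0); first exact: is_std0.
  by apply/seteqP; split=> // g gD; apply: nD; exists g.
have [z [_ vz wz _]] := dD; have [z' [_ vz' wz' _]] := d'D'.
rewrite dd' in wz; have [u vE uz] := ucat_prefix wz vz' wv'.
subst v'; exists (v ++ u), w', ((E' `&` wcat (w ++ u) @^-1` X) `&` wcat u @^-1` E).
split.
  apply: algebra_setI; last exact: algebra_preimage_wcat.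
  by apply: algebra_setI => //; apply: algebra_preimage_wcat; exact: algebra_setT.
apply/seteqP; split=> g.
  move=> [h [h' [[t [tE vt wt hd]] [t' [tE' vt' wt' hd']] /DR_compP[hh gr gd gs]]]].
  have /ucat_cat[s us ws] := vt'; rewrite hh in wt.
  have ts := ucat_tail wt ws; subst s.
  exists t'; split; rewrite ?gs//.
  - apply: stone_setI; last exact/(ucat_mem us).
    by apply: stone_setI => //; exact: ucat_follower vt'.
  - by rewrite gr; apply/ucat_cat; exists t.
  - by rewrite gd hd hd' !size_cat; lia.
move=> [t [tE /ucat_cat[s us vs] wt gd]].
have /ucat_ex[xi wux] : sval t (wcat (w ++ u) @^-1` X).
  apply: (stone_subset tE); last by move=> ? [[]].
  by apply: algebra_preimage_wcat; exact: algebra_setT.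
have /ucat_cat[s' us' ws] := wux.
have ss := ucat_fun us' us; rewrite {}ss in ws.
have [/ucatP[_ e1] /ucatP[_ e2]] := (ws, wux).
have [/ucatP[_ e3] /ucatP[_ e4]] := (vs, wt).
have [|h [hr hd hs]] := @DR_ex _ S (DR_range g) xi (size v) (size w); first by rewrite e1 e3.
have [|h' [hr' hd' hs']] := @DR_ex _ S xi (DR_source g) (size (w ++ u)) (size w').
  by rewrite e2 e4.
exists h, h'; split.
- exists s; rewrite hr hs; split=> //; apply/(ucat_mem us) => //.
  by apply: (stone_subset tE); [exact: algebra_preimage_wcat|exact: subIsetr].
- exists t; rewrite hr' hs'; split=> //.
  by apply: (stone_subset tE) => // ? [[]].
apply: DR_comp_intro; rewrite ?hr ?hs ?hr' ?hs' ?hd ?hd' ?gd//.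
rewrite !size_cat; lia.
Qed.

Lemma is_std_cob D : is_std D -> compact_open_bisection D.
Proof. by move=> [v [w [E [UE ->]]]]; exact: std_cob. Qed.

Lemma is_std_nbhs g (W : set G) : nbhs g W -> exists D, [/\ is_std D, D g & D `<=` W].
Proof.
move=> gW; have [v [w [z [vz wz gd]]]] := std_ex_at g.
have [E zE EW] := nbhs_std_ex vz wz gd gW.
exists (std v w E); split=> //; last by exists z.
by exists v, w, E; split=> //; exact: stone_algebra zE.
Qed.

Lemma is_std_deg D : is_std D -> exists m, D `<=` [set g | DR_deg g = m].
Proof. by move=> [v [w [E [_ ->]]]]; exists ((size v)%:Z - (size w)%:Z) => g [? []]. Qed.

End Groupoid.

Section Algebra.
Variables (K : fieldType) (A : finType) (S : subshift A).
Local Notation X := (subshift_set S).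
Local Notation U := (subshift_algebra_sets S).
Local Notation Y := (subshift_stone S).
Local Notation G := (DR (hatsigma_dom S) (hatsigma S)).
Local Notation V := (G -> K^o).
Local Notation AK := (subshift_algebra K S).
Local Notation mul := (subshift_mul K S).
Local Notation gr := (subshift_deg K S).
Implicit Types (x y : nat -> A) (u v w : seq A) (B C E P : set (nat -> A)).
Implicit Types (xi eta zeta theta : Y) (d g h k p q : G) (f a b : V) (D : set G).
Local Notation sh := (hatsigma S).

Lemma indic_in (T : Type) (D : set T) (t : T) : D t -> (\1_D : T -> K^o) t = 1.
Proof. by move=> Dt; rewrite indicE mem_set. Qed.

Lemma indic_out (T : Type) (D : set T) (t : T) : ~ D t -> (\1_D : T -> K^o) t = 0.
Proof. by move=> Dt; rewrite indicE memNset. Qed.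

Lemma indic_neq0 (T : Type) (D : set T) (t : T) : (\1_D : T -> K^o) t != 0 -> D t.
Proof. by move=> Dt; apply: contrapT => nD; move: Dt; rewrite indic_out// eqxx. Qed.

Definition std_span : set V := lin_span [set f | exists2 D, is_std D & f = \1_D].

(** Here the product is the pointwise one. It makes the span contain the indicator of a
    union whenever it contains those of the parts, by inclusion and exclusion. *)
Lemma std_span_mul f a : std_span f -> std_span a -> std_span (fun g => f g * a g).
Proof.
move=> + sa; elim/(@lin_span_ind K V): f / .
- by rewrite (_ : (fun _ => _) = 0); [exact: lin_span0|apply/funext => g; exact: mul0r].
- move=> f b sf sb; rewrite (_ : (fun _ => _) = (fun g => f g * a g) + (fun g => b g * a g)).
    exact: lin_spanD.
  by apply/funext => g; exact: mulrDl.
- move=> c f sf; rewrite (_ : (fun _ => _) = c *: (fun g => f g * a g)).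
    exact: lin_spanZ.
  by apply/funext => g; rewrite /= -mulrA.
move=> _ [D sD ->]; elim/(@lin_span_ind K V): a / sa.
- by rewrite (_ : (fun _ => _) = 0); [exact: lin_span0|apply/funext => g; exact: mulr0].
- move=> f b sf sb; rewrite (_ : (fun _ => _) = (fun g => \1_D g * f g) + (fun g => \1_D g * b g)).
    exact: lin_spanD.
  by apply/funext => g; exact: mulrDr.
- move=> c f sf; rewrite (_ : (fun _ => _) = c *: (fun g => \1_D g * f g)).
    exact: lin_spanZ.
  by apply/funext => g; exact: mulrCA.
move=> _ [D' sD' ->]; apply: lin_span_gen; exists (D `&` D'); first exact: is_std_setI.
apply/funext => g; rewrite !indicE in_setI.
by case: (g \in D); case: (g \in D'); rewrite /= ?mulr1 ?mulr0.
Qed.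

(** A compact open set is a finite union of standard bisections that it contains. *)
Lemma std_span_compact_open D : compact D -> open D -> std_span (\1_D : V).
Proof.
move=> cD oD.
have [|V1 V2 [V1D s1] [V2D s2]|g Dg|V1 [V1D s1] DV1] := @compact_union_ind _ D
    (fun V1 => V1 `<=` D /\ std_span (\1_V1 : V)) cD.
- by split=> //; apply: lin_span_gen; exists set0 => //; exact: is_std0.
- split; first by rewrite subUset.
  rewrite (_ : \1__ = (\1_V1 : V) + (\1_V2 + (-1) *: (fun g => \1_V1 g * \1_V2 g))).
    by apply: lin_spanD => //; apply: lin_spanD => //; apply: lin_spanZ; exact: std_span_mul.
  apply/funext => g; rewrite /= -[RHS]/(\1_V1 g + (\1_V2 g + (-1) * (\1_V1 g * \1_V2 g))).
  rewrite !indicE in_setU; case: (g \in V1); case: (g \in V2) => /=;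
    by rewrite ?mulr0 ?mulr1 ?mulN1r ?addr0 ?add0r ?oppr0 ?subrr ?addr0.
- have [D' [sD' D'g D'D]] := is_std_nbhs (open_nbhs_nbhs (conj oD Dg)).
  exists D'; first by split=> //; apply: lin_span_gen; exists D'.
  by apply: open_nbhs_nbhs; split=> //; have [] := is_std_cob sD'.
by rewrite (_ : D = V1)//; apply/seteqP.
Qed.

Lemma algebraE : AK = std_span.
Proof.
apply/seteqP; split; apply: lin_span_sub => _ [D DP ->].
  by have [cD oD _] := DP; exact: std_span_compact_open.
by apply: lin_span_gen; exists D => //; exact: is_std_cob.
Qed.

Lemma algebra_indic D : is_std D -> AK \1_D.
Proof. by move=> sD; rewrite algebraE; apply: lin_span_gen; exists D. Qed.

Lemma algebra0 : AK 0. Proof. exact: lin_span0. Qed.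
Lemma algebraD f a : AK f -> AK a -> AK (f + a). Proof. exact: lin_spanD. Qed.
Lemma algebraZ (c : K) f : AK f -> AK (c *: f). Proof. exact: lin_spanZ. Qed.

Lemma algebra_ind (P : V -> Prop) : P 0 -> (forall f a, P f -> P a -> P (f + a)) ->
  (forall (c : K) f, P f -> P (c *: f)) -> (forall D, is_std D -> P \1_D) ->
  forall f, AK f -> P f.
Proof.
move=> P0 PD PZ PS f; rewrite algebraE; apply: lin_span_ind => //.
by move=> _ [D sD ->]; exact: PS.
Qed.

Definition degree_part (m : int) f : V := fun g => if DR_deg g == m then f g else 0.

Lemma degree_part_deg m f : AK f -> gr m (degree_part m f).
Proof.
elim/algebra_ind: f / => [|f a sf sa|c f sf|D sD].
- rewrite (_ : degree_part m 0 = 0); first exact: lin_span0.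
  by apply/funext => g; rewrite /degree_part; case: ifP.
- rewrite (_ : degree_part m (f + a) = degree_part m f + degree_part m a); first exact: lin_spanD.
  by apply/funext => g; rewrite /degree_part /= -[RHS]/(_ + _)/=; case: ifP; rewrite ?addr0.
- rewrite (_ : degree_part m (c *: f) = c *: degree_part m f); first exact: lin_spanZ.
  by apply/funext => g; rewrite /degree_part /= -[RHS]/(_ *: _)/=; case: ifP; rewrite ?scaler0.
have [n Dn] := is_std_deg sD; have [<-|nm] := eqVneq n m.
  rewrite (_ : degree_part n \1_D = \1_D).
    by apply: lin_span_gen; exists D => //; split=> //; exact: is_std_cob.
  apply/funext => g; rewrite /degree_part; case: eqP => // ng.
  by rewrite indic_out// => /Dn.
rewrite (_ : degree_part m \1_D = 0); first exact: lin_span0.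
apply/funext => g; rewrite /degree_part; case: eqP => // gm.
by rewrite indic_out// => /Dn gn; move: nm; rewrite -gn gm eqxx.
Qed.

Lemma degreeP m f : gr m f <-> AK f /\ forall g, f g != 0 -> DR_deg g = m.
Proof.
split=> [|[Af fm]]; last first.
  rewrite (_ : f = degree_part m f); first exact: degree_part_deg.
  apply/funext => g; rewrite /degree_part; case: eqVneq => // ng.
  by apply/eqP; apply: contraNT ng => /fm ->.
move: f; apply: lin_span_ind => [|f a [Af fm] [Aa am]|c f [Af fm]|_ [D [DP Dm] ->]].
- by split=> [|g]; [exact: algebra0|rewrite eqxx].
- split=> [|g]; first exact: algebraD.
  have [f0|/fm//] := eqVneq (f g) 0; have [a0|/am//] := eqVneq (a g) 0.
  by rewrite -[(_ + _) g]/(f g + a g) f0 a0 addr0 eqxx.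
- split=> [|g]; first exact: algebraZ.
  have [f0|/fm//] := eqVneq (f g) 0.
  by rewrite -[(_ *: _) g]/(c *: f g) f0 scaler0 eqxx.
split=> [|g gD]; last exact: Dm (indic_neq0 gD).
by apply: lin_span_gen; exists D.
Qed.

(** The degree is constant on each of the finitely many standard bisections involved. *)
Lemma degree_bounded f : AK f -> exists N : nat, forall g, f g != 0 -> (`|DR_deg g| <= N)%N.
Proof.
elim/algebra_ind: f / => [|f a [N fN] [M aM]|c f [N fN]|D sD].
- by exists 0%N => g; rewrite eqxx.
- exists (maxn N M) => g.
  have [f0|/fN] := eqVneq (f g) 0; last by rewrite leq_max => ->.
  have [a0|/aM] := eqVneq (a g) 0; last by rewrite leq_max orbC => ->.
  by rewrite -[(_ + _) g]/(f g + a g) f0 a0 addr0 eqxx.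
- exists N => g; have [f0|/fN//] := eqVneq (f g) 0.
  by rewrite -[(_ *: _) g]/(c *: f g) f0 scaler0 eqxx.
have [n Dn] := is_std_deg sD; exists `|n|%N => g gD.
by rewrite (Dn _ (indic_neq0 gD)).
Qed.

(** This is what makes the sum that defines a convolution finite: [p] and [g] determine
    [q] when [p q = g], and all such [p] have the range of [g]. *)
Definition range_finite f := forall xi, finite_set [set g | DR_range g = xi /\ f g != 0].

Lemma algebra_range_finite f : AK f -> range_finite f.
Proof.
elim/algebra_ind: f / => [|f a Ff Fa|c f Ff|D sD] xi.
- by rewrite (_ : mkset _ = set0)//; apply/seteqP; split=> // g [_]; rewrite eqxx.
- apply: (@sub_finite_set _ _ ([set g | DR_range g = xi /\ f g != 0] `|`
                               [set g | DR_range g = xi /\ a g != 0])).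
    move=> g [gr]; have [f0|f0] := eqVneq (f g) 0; last by left.
    have [a0|a0] := eqVneq (a g) 0; last by right.
    by rewrite -[(_ + _) g]/(f g + a g) f0 a0 addr0 eqxx.
  by rewrite finite_setU.
- apply: sub_finite_set (Ff xi) => g [gr cf]; split=> //; apply: contraNneq cf => f0.
  by rewrite -[(_ *: _) g]/(c *: f g) f0 scaler0.
have [_ _ [Dr _]] := is_std_cob sD.
have [[g gP]|ng] := pselect (exists g, (\1_D : V) g != 0 /\ DR_range g = xi).
  apply: (@sub_finite_set _ _ [set g]); last exact: finite_set1.
  move=> h [hr hD]; have [gD gx] := gP.
  have [Dh Dg] := (indic_neq0 hD, indic_neq0 gD).
  by apply: Dr; [exact: mem_set|exact: mem_set|rewrite hr].
by rewrite (_ : mkset _ = set0)//; apply/seteqP; split=> // g [gr gD]; apply: ng; exists g.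
Qed.

Lemma convE f a g (F : set (G * G)) : F `<=` [set p | DR_comp p.1 p.2 g] ->
  (forall p q, DR_comp p q g -> ~ F (p, q) -> f p * a q = 0) ->
  mul f a g = \sum_(p \in F) f p.1 * a p.2.
Proof.
move=> Fg F0; rewrite /subshift_mul /convolution; symmetry; apply: fsbig_widen => //.
by move=> [p q] /= [pq nF]; exact: F0.
Qed.

Lemma conv_neq0 f a g : mul f a g != 0 ->
  exists p q, [/\ DR_comp p q g, f p != 0 & a q != 0].
Proof.
move=> fag; apply: contrapT => npq; move/eqP: fag; apply.
rewrite (@convE _ _ _ set0)// ?fsbig_set0// => p q pq _.
have [->|fp] := eqVneq (f p) 0; first by rewrite mul0r.
have [->|aq] := eqVneq (a q) 0; first by rewrite mulr0.
by exfalso; apply: npq; exists p, q.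
Qed.

Lemma conv_single f a g p q : DR_comp p q g ->
  (forall p' q', DR_comp p' q' g -> f p' != 0 -> a q' != 0 -> p' = p) ->
  mul f a g = f p * a q.
Proof.
move=> pq uniq; rewrite (@convE _ _ _ [set (p, q)]) ?fsbig_set1//; first by move=> _ ->.
move=> p' q' pq' ne.
have [->|fp] := eqVneq (f p') 0; first by rewrite mul0r.
have [->|aq] := eqVneq (a q') 0; first by rewrite mulr0.
exfalso; apply: ne; have pp := uniq _ _ pq' fp aq; subst p'.
by rewrite /= (DR_comp_injr pq pq').
Qed.

Lemma conv_indicl D a d k g : bisection D -> D d -> DR_comp d k g -> mul \1_D a g = a k.
Proof.
move=> [Dr _] Dd dk; rewrite (conv_single dk) ?indic_in ?mul1r//.
move=> p' q' pq' pD _; have Dp := indic_neq0 pD; apply: Dr; rewrite ?mem_set//.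
by have /DR_compP[_ <- _ _] := pq'; have /DR_compP[_ <- _ _] := dk.
Qed.

Lemma conv_indicr D a d k g : bisection D -> D d -> DR_comp k d g -> mul a \1_D g = a k.
Proof.
move=> [_ Ds] Dd kd; rewrite (conv_single kd) ?indic_in ?mulr1//.
move=> p' q' pq' _ qD; have Dq := indic_neq0 qD.
have dq : q' = d.
  apply: Ds; rewrite ?mem_set//.
  by have /DR_compP[_ _ _ <-] := pq'; have /DR_compP[_ _ _ <-] := kd.
by subst q'; exact: DR_comp_injl pq' kd.
Qed.

Lemma conv_finite f g : range_finite f ->
  finite_set [set p : G * G | DR_comp p.1 p.2 g /\ f p.1 != 0].
Proof.
move=> /(_ (DR_range g)) Ff.
apply: sub_finite_set (finite_image (fun p => (p, xget p [set k | DR_comp p k g])) Ff).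
move=> [p q] /= [pq fp]; exists p; first by have /DR_compP[_ -> _ _] := pq.
by congr pair; apply: xget_unique => // k kP; exact: DR_comp_injr kP pq.
Qed.

Lemma convE_finite f a g (F : set (G * G)) : range_finite f ->
  [set p | DR_comp p.1 p.2 g /\ f p.1 != 0] `<=` F -> F `<=` [set p | DR_comp p.1 p.2 g] ->
  mul f a g = \sum_(p \in F) f p.1 * a p.2.
Proof.
move=> Ff fF Fg; apply: convE => // p q pq nF.
have [->|fp] := eqVneq (f p) 0; first by rewrite mul0r.
by exfalso; apply: nF; exact: fF.
Qed.

Lemma convDl f b a : range_finite f -> range_finite b ->
  mul (f + b) a = mul f a + mul b a.
Proof.
move=> Ff Fb; apply/funext => g; rewrite -[RHS]/(mul f a g + mul b a g).
set F := [set p : G * G | DR_comp p.1 p.2 g /\ f p.1 != 0] `|`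
         [set p : G * G | DR_comp p.1 p.2 g /\ b p.1 != 0].
have finF : finite_set F by rewrite finite_setU; split; exact: conv_finite.
have Fg : F `<=` [set p | DR_comp p.1 p.2 g] by move=> p [[]|[]].
rewrite (@convE f a g F)//; last first.
  move=> p q pq nF; have [->|fp] := eqVneq (f p) 0; first by rewrite mul0r.
  by exfalso; apply: nF; left.
rewrite (@convE b a g F)//; last first.
  move=> p q pq nF; have [->|fp] := eqVneq (b p) 0; first by rewrite mul0r.
  by exfalso; apply: nF; right.
rewrite (@convE (f + b) a g F)//; last first.
  move=> p q pq nF; rewrite -[(f + b) p]/(f p + b p).
  have [->|fp] := eqVneq (f p) 0; last by exfalso; apply: nF; left.
  have [->|bp] := eqVneq (b p) 0; last by exfalso; apply: nF; right.
  by rewrite addr0 mul0r.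
rewrite -fsbig_split//; apply: eq_fsbigr => p _.
exact: mulrDl.
Qed.

Lemma convDr f a b : range_finite f -> mul f (a + b) = mul f a + mul f b.
Proof.
move=> Ff; apply/funext => g; rewrite -[RHS]/(mul f a g + mul f b g).
have finF := conv_finite g Ff; set F := mkset _ in finF.
have Fg : F `<=` [set p | DR_comp p.1 p.2 g] by move=> p [].
rewrite !(@convE_finite _ _ _ F)// -fsbig_split//; apply: eq_fsbigr => p _.
exact: mulrDr.
Qed.

Lemma convZl (c : K) f a : mul (c *: f) a = c *: mul f a.
Proof.
apply/funext => g; rewrite -[RHS]/(c * mul f a g) /subshift_mul /convolution mulr_fsumr.
by apply: eq_fsbigr => p _; rewrite mulrA.
Qed.

Lemma convZr (c : K) f a : mul f (c *: a) = c *: mul f a.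
Proof.
apply/funext => g; rewrite -[RHS]/(c * mul f a g) /subshift_mul /convolution mulr_fsumr.
by apply: eq_fsbigr => p _; rewrite mulrCA.
Qed.

Lemma conv0l a : mul 0 a = 0.
Proof. by have := convZl 0 0 a; rewrite !scale0r. Qed.

Lemma conv0r a : mul a 0 = 0.
Proof. by have := convZr 0 a 0; rewrite !scale0r. Qed.

Lemma algebra_mul f a : AK f -> AK a -> AK (mul f a).
Proof.
move=> Af Aa; suff : AK f /\ AK (mul f a) by case.
elim/algebra_ind: f / Af.
- by rewrite conv0l; split; exact: algebra0.
- move=> f b [Af Afa] [Ab Aba]; rewrite convDl; try exact: algebra_range_finite.
  by split; exact: algebraD.
- by move=> c f [Af Afa]; rewrite convZl; split; exact: algebraZ.
move=> D sD; split; first exact: algebra_indic.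
elim/algebra_ind: a / Aa.
- by rewrite conv0r; exact: algebra0.
- move=> a b Aa Ab; rewrite convDr; first exact: algebraD.
  by apply: algebra_range_finite; exact: algebra_indic.
- by move=> c a Aa; rewrite convZr; exact: algebraZ.
move=> D' sD'; have [[_ _ bD] [_ _ bD']] := (is_std_cob sD, is_std_cob sD').
rewrite /subshift_mul convolution_indic//; apply: algebra_indic.
exact: is_std_setmul.
Qed.

End Algebra.

(** * Minimality and graded ideals *)

Section Minimality.
Variables (K : fieldType) (A : finType) (S : subshift A).
Local Notation X := (subshift_set S).
Local Notation U := (subshift_algebra_sets S).
Local Notation Y := (subshift_stone S).
Local Notation basic := (@stone_open _ X U).
Local Notation G := (DR (hatsigma_dom S) (hatsigma S)).
Local Notation V := (G -> K^o).
Local Notation AK := (subshift_algebra K S).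
Local Notation mul := (subshift_mul K S).
Local Notation gr := (subshift_deg K S).
Implicit Types (x y : nat -> A) (u v w : seq A) (B C E P : set (nat -> A)).
Implicit Types (xi eta zeta theta : Y) (d g h k p q : G) (f a b : V) (D : set G).
Local Notation sh := (hatsigma S).

Lemma minimalP : minimal_groupoid (hatsigma_dom S) sh <->
  forall xi E, U E -> (exists x, E x) -> exists g, DR_source g = xi /\ sval (DR_range g) E.
Proof.
split=> [minG xi E UE [x Ex]|minG xi W [eta Weta] oW].
  have [|eta [etaE [g gs geta]]] := minG xi (basic E) _ (open_basic UE); last first.
    by exists g; rewrite geta.
  by exists (principal (algebra_sub UE Ex)).
have [B etaB BW] := nbhs_basic_ex (open_nbhs_nbhs (conj oW Weta)).
have [g [gs gB]] := minG xi B (stone_algebra etaB) (stone_nonempty etaB).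
by exists (DR_range g); split; [exact: BW|exists g].
Qed.

Lemma DR_unit_ex xi : exists g, [/\ DR_range g = xi, DR_deg g = 0 & DR_source g = xi].
Proof. by have [g [gr gd gs]] := @DR_ex _ S xi xi 0 0 erefl; exists g. Qed.

(** The points [(xi, m, sigma^m xi)] have infinitely many different degrees and remain
    visible modulo [I], while finitely many elements of the algebra live in boundedly
    many degrees. *)
Lemma quotient_infinite_dim (I : set V) xi :
  (forall f, I f -> forall g, DR_range g = xi -> f g = 0) -> ~ fin_dim_quotient AK I.
Proof.
move=> I0 [n [s [sA sI]]].
have [N sN] := choice (fun i => degree_bounded (sA i)).
pose m := (\max_(i < n) N i).+1.
have [g [gr gd gs]] := @DR_ex _ S xi (iter m sh xi) m 0 erefl.
have [D [sD Dg _]] := @is_std_nbhs _ S g setT filterT.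
have [c /I0/(_ g gr)] := sI _ (algebra_indic K sD).
suff -> : (\1_D - \sum_(i < n) c i *: s i) g = 1 :> K by move/eqP; rewrite oner_eq0.
rewrite -[LHS]/((\1_D : V) g - (\sum_(i < n) c i *: s i) g) indic_in// fct_sumE.
rewrite big1 ?subr0// => i _.
have [sg|/sN] := eqVneq (s i g) 0; first by rewrite -[LHS]/(c i * s i g) sg mulr0.
by move=> /leq_trans/(_ (leq_bigmax i)); rewrite gd subr0 absz_nat ltnn.
Qed.

Lemma homogeneous_sum (h : int -> V) g : finite_set [set m | h m <> 0] ->
  (forall m g, h m g != 0 -> DR_deg g = m) ->
  (\sum_(m \in [set: int]) h m) g = h (DR_deg g) g.
Proof.
move=> hfin hdeg; set l := finite_support _ _ _.
have lP : l =i [set m | h m <> 0].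
  by move=> m; rewrite in_finite_support setTI.
have lu : uniq l := finite_support_uniq _ _ _.
rewrite fct_sumE; have [gl|gl] := boolP (DR_deg g \in l).
  rewrite (bigD1_seq (DR_deg g))//= big1 ?addr0// => m mg.
  by apply/eqP; apply: contraNT mg => /hdeg ->.
have h0 : h (DR_deg g) = 0.
  by apply: contrapT => hg; move: gl; rewrite lP mem_set.
rewrite h0 big1_seq// => m /andP[_ ml].
by apply/eqP; apply: contraNT gl => /hdeg ->.
Qed.

Definition orbit_ideal (W : set Y) : set V :=
  [set f | AK f /\ forall g, f g != 0 -> W (DR_range g)].

(** A product [p q] has its range in the orbit of the ranges of [p] and of [q], so
    convolution keeps supports over [W]; and passing to a homogeneous component only
    shrinks the support. *)
Lemma orbit_idealP (W : set Y) : (forall g, W (DR_range g) <-> W (DR_source g)) ->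
  graded_ideal mul AK gr (orbit_ideal W).
Proof.
move=> Winv.
have I0 : orbit_ideal W 0 by split=> [|g]; [exact: algebra0|rewrite eqxx].
have ID f a : orbit_ideal W f -> orbit_ideal W a -> orbit_ideal W (f + a).
  move=> [Af fW] [Aa aW]; split=> [|g]; first exact: algebraD.
  have [f0|/fW//] := eqVneq (f g) 0; have [a0|/aW//] := eqVneq (a g) 0.
  by rewrite -[(_ + _) g]/(f g + a g) f0 a0 addr0 eqxx.
split; first split=> //.
- by move=> f [].
- move=> c f [Af fW]; split=> [|g]; first exact: algebraZ.
  have [f0|/fW//] := eqVneq (f g) 0.
  by rewrite -[(_ *: _) g]/(c *: f g) f0 scaler0 eqxx.
- move=> a f Aa [Af fW]; split; (split=> [|g]; first exact: algebra_mul).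
    move=> /conv_neq0[p [q [/DR_compP[_ _ _ gs] _ /fW Wq]]].
    by apply/Winv; rewrite gs; apply/Winv.
  by move=> /conv_neq0[p [q [/DR_compP[_ gr _ _] /fW Wq _]]]; rewrite gr.
split=> [h hfin hI|f [Af fW]].
  by apply: big_ind => // m _; have [] := hI m.
have dfin : finite_set [set m | degree_part m f <> 0].
  have [N fN] := degree_bounded Af.
  apply: (@sub_finite_set _ _ ((fun n : nat => n%:Z) @` `I_N.+1 `|`
                               (fun n : nat => - n%:Z) @` `I_N.+1)).
    move=> m mf; have [g fg] : exists g, degree_part m f g != 0.
      apply: contrapT => ng; apply: mf; apply/funext => g.
      by apply/eqP; apply: contrapT => /negP fg; apply: ng; exists g.
    move: fg; rewrite /degree_part; case: (DR_deg g =P m) => [gm fg|_]; last by rewrite eqxx.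
    have mN := fN _ fg; rewrite gm in mN.
    by have [m0|m0] := leP 0 m; [left|right]; exists `|m|%N => /=; lia.
  by rewrite finite_setU; split; apply: finite_image; exact: finite_II.
exists (fun m => degree_part m f); split; first split=> //.
- move=> m; split; first exact: degree_part_deg.
  split=> [|g]; first by have /degreeP[] := degree_part_deg m Af.
  by rewrite /degree_part; case: (DR_deg g =P m) => [_ fg|_]; [exact: fW|rewrite eqxx].
- apply/funext => g; rewrite homogeneous_sum//.
    by rewrite /degree_part eqxx.
  by move=> m {}g; rewrite /degree_part; case: (DR_deg g =P m) => //; rewrite eqxx.
move=> h [hfin hI fE]; apply/funext => m; apply/funext => g.
have hdeg n k : h n k != 0 -> DR_deg k = n.
  by move=> hk; have [/degreeP[_ +] _] := hI n; apply.
rewrite /degree_part fE homogeneous_sum//; case: eqVneq => [->//|gm].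
by symmetry; apply/eqP; apply: contraNT gm => /hdeg ->.
Qed.

(** The copy of [O_B] in the unit space. *)
Definition unit_set B : set G := std [::] [::] B.

Lemma unit_setP B g : unit_set B g <->
  [/\ sval (DR_range g) B, DR_range g = DR_source g & DR_deg g = 0].
Proof.
have nil zeta xi : ucat [::] zeta xi -> xi = zeta.
  by move=> /ucat_fun/(_ (ucat_nil zeta)).
split=> [[z [zB /nil -> /nil -> ->]]//|[gB gE g0]].
by exists (DR_range g); split=> //; [exact: ucat_nil|rewrite gE; exact: ucat_nil].
Qed.

Lemma is_std_unit_set B : U B -> is_std (unit_set B).
Proof. by move=> UB; exists [::], [::], B. Qed.

Lemma conv_unitl B f g : mul \1_(unit_set B) f g = \1_(basic B) (DR_range g) * f g.
Proof.
have [gB|gB] := pselect (sval (DR_range g) B).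
  have [d [dr dd ds]] := DR_unit_ex (DR_range g).
  rewrite indic_in// mul1r (@conv_indicl _ _ _ _ f d g)//.
  - exact: std_bisection.
  - by apply/unit_setP; rewrite dr ds.
  - by apply: DR_comp_intro; rewrite ?dr ?dd ?add0r.
rewrite indic_out// mul0r; apply/eqP; apply: contrapT => /negP/conv_neq0.
move=> [p [q [/DR_compP[_ pr _ _] pB _]]]; apply: gB; rewrite pr.
by have /unit_setP[] := indic_neq0 pB.
Qed.

Lemma conv_unitr B f g : mul f \1_(unit_set B) g = f g * \1_(basic B) (DR_source g).
Proof.
have [gB|gB] := pselect (sval (DR_source g) B).
  have [d [dr dd ds]] := DR_unit_ex (DR_source g).
  rewrite [in RHS]indic_in// mulr1 (@conv_indicr _ _ _ _ f d g)//.
  - exact: std_bisection.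
  - by apply/unit_setP; rewrite dr ds.
  - by apply: DR_comp_intro; rewrite ?ds ?dd ?addr0.
rewrite [in RHS]indic_out// mulr0; apply/eqP; apply: contrapT => /negP/conv_neq0.
move=> [p [q [/DR_compP[_ _ _ qs] _ qB]]]; apply: gB; rewrite qs.
by have /unit_setP[qr <- _] := indic_neq0 qB.
Qed.

(** If the orbit of [xi] misses [O_E], then the functions supported over the points whose
    orbits meet [O_E] form a graded ideal. It contains the indicator of [O_E], and its
    quotient is infinite dimensional because its elements vanish over [xi]. *)
Lemma graded_just_infinite_minimal : graded_just_infinite mul AK gr ->
  minimal_groupoid (hatsigma_dom S) sh.
Proof.
move=> [_ ji]; apply/minimalP => xi E UE [x Ex]; apply: contrapT => nxi.
pose W : set Y := [set eta | exists g, DR_source g = eta /\ sval (DR_range g) E].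
have [//||n [s [sA sI]]] := ji (orbit_ideal W).
- apply: orbit_idealP => g; split=> -[h [hs hE]].
    have [k /DR_compP[_ kr _ ks]] := DR_comp_ex hs.
    by exists k; rewrite kr ks.
  have [g' [gr' _ gs']] := DR_inv_ex g.
  have [|k /DR_compP[_ kr _ ks]] := @DR_comp_ex _ _ h g'; first by rewrite gr'.
  by exists k; rewrite kr ks.
- move=> I0; have [g [gr gd gs]] := DR_unit_ex (principal (algebra_sub UE Ex)).
  have uE : (\1_(unit_set E) : V) g = 1.
    by apply: indic_in; apply/unit_setP; rewrite gr gs gd.
  have : orbit_ideal W \1_(unit_set E).
    split=> [|k kE]; first exact/algebra_indic/is_std_unit_set.
    have /unit_setP[kr ke _] := indic_neq0 kE.
    by exists k.
  by rewrite I0 => e; move/eqP: uE; rewrite e eq_sym oner_eq0.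
- suff : ~ fin_dim_quotient AK (orbit_ideal W) by apply; exists n, s.
  apply: (@quotient_infinite_dim _ xi) => f [Af fW] g gr.
  by apply/eqP; apply: contrapT => /negP/fW; rewrite gr.
Qed.

(** The only nonzero graded ideal is the whole algebra, whose quotient is zero; that the
    algebra itself is infinite dimensional is the case of the zero ideal above. *)
Lemma graded_simple_just_infinite : X !=set0 -> graded_simple mul AK gr ->
  graded_just_infinite mul AK gr.
Proof.
move=> [x Xx] simple; split.
  by apply: (@quotient_infinite_dim _ (principal Xx)) => _ -> g _.
move=> J gJ J0; have [//|->] := simple J gJ.
exists 0%N, (fun=> 0); split=> [[]//|a Aa]; exists (fun=> 0).
by rewrite big_ord0 subr0.
Qed.

(** The kernel of the degree map is a principal groupoid, in the following strong form:
    if [|v| = |w|] and [v <> w], then the cylinders of [v] and [w] are disjoint, so that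
    [std v w E] has no point with both ends in the cylinder of [v]. Near a unit, an
    element of the algebra is thus in degree 0 a multiple of the indicator of the units. *)
Lemma degree0_local f xi : AK f -> exists2 B, sval xi B & exists c : K, forall g,
  DR_deg g = 0 -> sval (DR_range g) B -> sval (DR_source g) B ->
  f g = if `[< DR_range g = DR_source g >] then c else 0.
Proof.
elim/algebra_ind: f / => [|f a [B xB [c fB]] [C xC [e aC]]|k f [B xB [c fB]]|_ [v [w [E [UE ->]]]]].
- exists X; [exact: stone_setT|exists 0 => g _ _ _].
  by case: ifP.
- exists (B `&` C); [exact: stone_setI|exists (c + e) => g g0 grBC gsBC].
  have [UB UC] := (stone_algebra xB, stone_algebra xC).
  have subB eta : sval eta (B `&` C) -> sval eta B.
    by move=> /stone_subset; apply=> //; exact: subIsetl.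
  have subC eta : sval eta (B `&` C) -> sval eta C.
    by move=> /stone_subset; apply=> //; exact: subIsetr.
  rewrite -[LHS]/(f g + a g) fB ?aC//; do ?[exact: subB|exact: subC].
  by case: ifP; rewrite ?addr0.
- exists B => //; exists (k * c) => g g0 gr gs; rewrite -[LHS]/(k * f g) fB//.
  by case: ifP; rewrite ?mulr0.
have UQ := algebra_cat_set v UE.
have stdQ g : std v w E g -> sval (DR_range g) (cat_set S v E).
  by move=> [z [zE vz _ _]]; apply/mem_cat_set => //; exists z.
have [xQ|nxQ] := pselect (sval xi (cat_set S v E)); last first.
  exists (X `\` cat_set S v E); first exact: stone_setC.
  exists 0 => g _ gQ _; rewrite indic_out; first by case: ifP.
  by move=> /stdQ gQ'; have [y [? []]] := stone_nonempty (stone_setI gQ' gQ).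
exists (cat_set S v E) => //; exists (v == w)%:R => g g0 grQ gsQ.
have /mem_cat_set[//|z vz zE] := grQ; have /mem_cat_set[//|z' vz' zE'] := gsQ.
have [vw|vw] := eqVneq v w; last first.
  rewrite indic_out; first by case: ifP.
  move=> [z'' [_ vz'' wz'' gd]]; move/eqP: vw; apply.
  by apply: ucat_prefix_uniq vz' wz'' _; rewrite g0 in gd; lia.
case: asboolP => ge.
  by apply: indic_in; exists z; rewrite -vw -ge g0 subrr.
apply: indic_out => -[z'' [_ vz'' wz'' gd]]; apply: ge; rewrite -vw in wz''.
exact: ucat_fun vz'' wz''.
Qed.

(** Multiplying a homogeneous element by the inverse of a standard bisection through a point
    [g] of its support gives an element of degree 0 that does not vanish at the unit
    [r(g)]. Cut down on both sides to a small neighbourhood of this unit, it becomes a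
    nonzero multiple of an indicator. *)
Lemma unit_indic_ideal_local (I : set V) f g : graded_ideal mul AK gr I ->
  I f -> f g != 0 -> exists2 B, sval (DR_range g) B & I \1_(unit_set B).
Proof.
move=> [[IA I0 ID IZ IM] [_ Igr]] If0 fg0.
have {f If0 fg0}[m [f [If fm fg]]] :
    exists m a, [/\ I a, (forall g, a g != 0 -> DR_deg g = m) & a g != 0].
  have [h [[hfin hI fE] _]] := Igr f If0.
  have hdeg n k : h n k != 0 -> DR_deg k = n.
    by move=> hk; have [/degreeP[_ +] _] := hI n; apply.
  exists (DR_deg g), (h (DR_deg g)); split=> [|k|].
  - by have [] := hI (DR_deg g).
  - exact: hdeg.
  - by rewrite -homogeneous_sum// -fE.
have [D [sD Dg _]] := @is_std_nbhs _ S g setT filterT.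
have sD' : is_std (DR_setinv D).
  by have [v [w [E [UE ->]]]] := sD; exists w, v, E; rewrite setinv_std.
have [n Dn] := is_std_deg sD.
pose a := mul f \1_(DR_setinv D).
have Ia : I a by have [] := IM _ _ (algebra_indic K sD') If.
have adeg k : a k != 0 -> DR_deg k = 0.
  move=> /conv_neq0[p [q [/DR_compP[_ _ -> _] /fm -> qD]]].
  have [d Dd [_ -> _]] := indic_neq0 qD.
  by rewrite (Dn _ Dd) -(Dn _ Dg) (fm _ fg) subrr.
have [u [ur ud us]] := DR_unit_ex (DR_range g).
have au : a u != 0.
  have [g' [gr' gd' gs']] := DR_inv_ex g.
  have [_ _ bD'] := is_std_cob sD'.
  rewrite /a (@conv_indicr _ _ _ _ f g' g u)//; first by exists g.
  by apply: DR_comp_intro; rewrite ?gr' ?ur ?ud ?us ?gs' ?gd' ?subrr.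
have [B gB [c aB]] := degree0_local (DR_range g) (IA _ Ia).
have UB := stone_algebra gB; have AB := algebra_indic K (is_std_unit_set UB).
have c0 : c != 0.
  by move: au; rewrite aB ?ur ?us//; case: asboolP.
exists B => //; rewrite (_ : \1_(unit_set B) = c^-1 *: mul \1_(unit_set B) (mul a \1_(unit_set B))).
  by apply: (IZ c^-1); have [] := IM _ _ AB Ia => _ /(IM _ _ AB)[].
apply/funext => k; rewrite -[RHS]/(c^-1 * mul \1_(unit_set B) (mul a \1_(unit_set B)) k).
rewrite conv_unitl conv_unitr.
have [kB|kB] := pselect (sval (DR_range k) B); last first.
  by rewrite [in RHS]indic_out// mul0r mulr0 indic_out// => /unit_setP[].
have [kB'|kB'] := pselect (sval (DR_source k) B); last first.
  rewrite (@indic_out K _ (basic B) (DR_source k))// !mulr0 indic_out// => /unit_setP[kE ke _].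
  by apply: kB'; rewrite -ke.
rewrite (@indic_in K _ (basic B) (DR_source k))//.
rewrite (@indic_in K _ (basic B) (DR_range k))// mul1r mulr1.
have [k0|k0] := eqVneq (DR_deg k) 0; last first.
  have -> : a k = 0 by apply/eqP; apply: contraNT k0 => /adeg ->.
  by rewrite mulr0 indic_out// => /unit_setP[_ _]; exact/eqP.
rewrite aB//; case: asboolP => ke; first by rewrite mulVf// indic_in//; apply/unit_setP.
by rewrite mulr0 indic_out// => /unit_setP[].
Qed.

(** This is [s_w p_E s_v^* s_v p_E s_w^* = s_w p_E s_w^*], which holds since [v] can
    precede every point of [E]. *)
Lemma std_inv_mul v w E : U E -> E `<=` wcat v @^-1` X ->
  DR_setmul (std w v E) (std v w E) = unit_set (cat_set S w E).
Proof.
move=> UE Ev; apply/seteqP; split=> g.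
  move=> [h [k [[z [zE wz vz hd]] [z' [zE' vz' wz' kd]] /DR_compP[hk gr gd gs]]]].
  rewrite hk in vz; have zz := ucat_tail vz vz'; subst z'.
  apply/unit_setP; rewrite gr gs gd hd kd; split.
  - by apply/mem_cat_set => //; exists z.
  - exact: ucat_fun wz wz'.
  - lia.
move=> /unit_setP[/mem_cat_set[//|z wz zE] ge gd].
have [xi vz] : exists xi, ucat v z xi.
  apply: ucat_ex; apply: (stone_subset zE) => //.
  by apply: algebra_preimage_wcat; exact: algebra_setT.
have [/ucatP[_ e1] /ucatP[_ e2]] := (wz, vz).
have [|h [hr hd hs]] := @DR_ex _ S (DR_range g) xi (size w) (size v); first by rewrite e1 e2.
have [|k [kr kd ks]] := @DR_ex _ S xi (DR_source g) (size v) (size w); first by rewrite -ge e1 e2.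
exists h, k; split.
- by exists z; rewrite hr hs.
- by exists z; rewrite kr ks -ge.
by apply: DR_comp_intro; rewrite ?hr ?hs ?kr ?ks ?hd ?kd ?gd//; lia.
Qed.

(** Once an ideal contains the indicator of one nonempty [O_B], conjugation by standard
    bisections carries it along the orbits, which all meet [O_B]. The sets whose indicators
    lie in the ideal are closed under union, so compactness yields the unit of the algebra. *)
Lemma minimal_graded_simple : minimal_groupoid (hatsigma_dom S) sh ->
  graded_simple mul AK gr.
Proof.
move=> /minimalP minG I gI; have [->|I0] := pselect (I = [set 0]); first by left.
right; have [[IA I00 ID IZ IM] _] := gI.
have [f If [g fg]] : exists2 f, I f & exists g, f g != 0.
  apply: contrapT => nI; apply: I0; apply/seteqP; split=> [f If|_ ->//].
  apply/funext => g; apply/eqP; apply: contrapT => /negP fg.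
  by apply: nI; exists f => //; exists g.
have [B gB IB] := unit_indic_ideal_local gI If fg; have UB := stone_algebra gB.
suff IX : I \1_(unit_set X).
  apply/seteqP; split=> // a Aa; rewrite (_ : a = mul a \1_(unit_set X)).
    by have [] := IM _ _ Aa IX.
  apply/funext => k; rewrite conv_unitr indic_in ?mulr1//.
  exact: stone_setT.
suff [] : U X /\ I \1_(unit_set X) by [].
apply: (@stone_compact_ind _ S (fun B => U B /\ I (\1_(unit_set B) : V))).
- split; first exact: algebra_set0.
  rewrite (_ : \1__ = 0)//; apply/funext => k; apply: indic_out.
  by move=> /unit_setP[/stone_set0].
- move=> C E UC UE [_ IC] [_ IE]; split; first exact: algebra_setU.
  have -> : (\1_(unit_set (C `|` E)) : V) = (\1_(unit_set C) : V) + ((\1_(unit_set E) : V) +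
      (-1 : K) *: mul \1_(unit_set C) \1_(unit_set E)); last first.
    apply: (ID) => //; apply: (ID \1_(unit_set E)) => //; apply: (IZ (-1)).
    by have [] := IM _ _ (algebra_indic K (is_std_unit_set UC)) IE.
  apply/funext => k; rewrite -[RHS]/((\1_(unit_set C) : V) k + (\1_(unit_set E) k +
      (-1) * mul \1_(unit_set C) \1_(unit_set E) k)) conv_unitl.
  have [[ke kd]|nk] := pselect (DR_range k = DR_source k /\ DR_deg k = 0); last first.
    have out F : ~ unit_set F k by move=> /unit_setP[_ ??]; exact: nk.
    by rewrite !(@indic_out K _ (unit_set _))// !mulr0 !addr0.
  have uP F : unit_set F k <-> sval (DR_range k) F by split=> [/unit_setP[]//|kF]; exact/unit_setP.
  have [kC|kC] := pselect (sval (DR_range k) C).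
    rewrite (@indic_in K _ (unit_set C)) ?(@indic_in K _ (basic C))//; last exact/uP.
    rewrite mul1r mulN1r subrr addr0 indic_in//; apply/uP.
    by apply: (stone_subset kC); [exact: algebra_setU|left].
  rewrite (@indic_out K _ (unit_set C)) ?(@indic_out K _ (basic C))//; last by move=> /uP.
  rewrite mul0r mulr0 addr0 add0r.
  have [kE|kE] := pselect (sval (DR_range k) E).
    rewrite !indic_in//; first exact/uP.
    by apply/uP; apply: (stone_subset kE); [exact: algebra_setU|right].
  rewrite !indic_out//; first by move=> /uP.
  move=> /uP kCE; apply: kE; apply: (stone_subset (stone_setI kCE (stone_setC UC kC))) => //.
  by move=> x [[Cx|Ex] [_ nCx]].
move=> xi; have [h [hs hB]] := minG xi B UB (stone_nonempty gB).
have [v [w [z [vz wz hd]]]] := std_ex_at h; rewrite hs in wz.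
pose E := wcat v @^-1` B; have UE : U E by exact: algebra_preimage_wcat.
have zE : sval z E by exact/(ucat_mem vz).
have sE : is_std (@std _ S v w E) by exists v, w, E.
have sE' : is_std (@std _ S w v E) by exists w, v, E.
exists (cat_set S w E); last by apply/mem_cat_set => //; exists z.
split; first exact: algebra_cat_set.
rewrite -(@std_inv_mul v)//; last by move=> y Ey; exact: algebra_sub UB _ Ey.
have [[_ _ bE] [_ _ bE']] := (is_std_cob sE, is_std_cob sE').
rewrite -(@convolution_indic K)//.
rewrite (_ : \1_(std v w E) = mul \1_(unit_set B) \1_(std v w E)).
  have [_ IBE] := IM _ _ (algebra_indic K sE) IB.
  by have [] := IM _ _ (algebra_indic K sE') IBE.
apply/funext => k; rewrite conv_unitl.
have [kE|kE] := pselect (std v w E k); last first.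
  by rewrite !(@indic_out K _ (std v w E))// mulr0.
rewrite !indic_in ?mulr1//; have [z' [z'E vz' _ _]] := kE.
exact/(ucat_mem vz').
Qed.

End Minimality.

(** * Minimality and hyper cofinality *)

Section HyperCofinal.
Variables (A : finType) (S : subshift A).
Local Notation X := (subshift_set S).
Local Notation U := (subshift_algebra_sets S).
Local Notation Y := (subshift_stone S).
Local Notation G := (DR (hatsigma_dom S) (hatsigma S)).
Implicit Types (x y z : nat -> A) (u v w d e : seq A) (B C E P : set (nat -> A)).
Implicit Types (xi eta zeta theta : Y).
Local Notation sh := (hatsigma S).

(** [X] is closed: points of [X] agreeing with [x] on longer and longer prefixes would
    converge to [x]. *)
Lemma subshift_open_compl x : ~ X x ->
  exists n, forall y, (forall i, (i < n)%N -> y i = x i) -> ~ X y.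
Proof.
move=> nXx; apply: contrapT => nn; apply: nXx.
have /choice[y yP] n : exists y, (forall i, (i < n)%N -> y i = x i) /\ X y.
  apply: contrapT => ny; apply: nn; exists n => y yx Xy; apply: ny; by exists y.
pose T := prod_topology (fun _ : nat => discrete_topology A).
have cl : closed (X : set T) := @subshift_closed _ S.
apply: (@closed_cvg nat T \oo _ (y : nat -> T) (X : T -> Prop) cl _ x).
  by apply: nearW => n; have [] := yP n.
apply/cvg_sup => i W /=.
rewrite (@nbhsE (initial_topology (fun f : T => f i))) => -[_ [[C oC <-] Cx] CW].
apply: filterS CW _; exists i.+1 => // n /= ni.
by rewrite /preimage /=; have [-> //] := yP n.
Qed.

Lemma wcat_agree w y z i : (i < size w)%N -> wcat w y i = wcat w z i.
Proof. by elim: w i => // a w IHw [|i] //= /IHw. Qed.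

Lemma wcat_prefix d w y z : (size w <= size d)%N -> wcat d z = wcat w y ->
  exists2 e, d = w ++ e & y = wcat e z.
Proof.
move=> wd e; have tw : take (size w) d = w.
  have st : size (take (size w) d) = size w by rewrite size_takel.
  rewrite -[LHS](factor_wcat _ (wcat (drop (size w) d) z)) -wcat_cat cat_take_drop.
  by rewrite e st factor_wcat.
exists (drop (size w) d); first by rewrite -{1}tw cat_take_drop.
by apply: (@wcat_inj _ w); rewrite -e -wcat_cat -{1}tw cat_take_drop.
Qed.

(** Write [x = d z] with [d] long. Then membership in [E] stays the same when [z] is replaced
    by any point satisfying a finite list of follower conditions that hold for [z]. For
    a generator [C(v, w)] and [x = w y], the condition that [v y] be in [X] is itself such a
    condition; if it fails, it fails because of a finite prefix of [y], since [X] is closed,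
    and this prefix is absorbed into [d]. Quantifying over all long [d] allows several
    sets to be treated at once. *)
Lemma algebra_local E x : U E -> X x -> exists n, forall d z,
  x = wcat d z -> (n <= size d)%N -> exists s : seq (seq A),
  [/\ d \in s, forall b, b \in s -> X (wcat b z) &
      forall z', (forall b, b \in s -> X (wcat b z')) -> E (wcat d z') <-> E x].
Proof.
pose Q E := E `<=` X /\ forall x, X x -> exists n, forall d z,
  x = wcat d z -> (n <= size d)%N -> exists s : seq (seq A),
  [/\ d \in s, forall b, b \in s -> X (wcat b z) &
      forall z', (forall b, b \in s -> X (wcat b z')) -> E (wcat d z') <-> E x].
suff sub : U `<=` [set E | Q E] by move=> /sub[_] /[apply].
have single d z : X (wcat d z) -> d \in [:: d] /\ forall b, b \in [:: d] -> X (wcat b z).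
  by move=> Xdz; split=> [|b]; rewrite inE// => /eqP ->.
apply: smallest_sub; first split.
- by move=> C [].
- split=> // {}x Xx; exists 0%N => d z xE _; exists [:: d].
  have [] := single d z; rewrite -?xE// => ??; split=> // z' /(_ d); rewrite mem_head => /(_ isT).
  by split.
- move=> C [CX QC]; split; first exact: subDsetl.
  move=> {}x Xx; have [n xn] := QC x Xx; exists n => d z xE nd.
  have [s [ds sz sz']] := xn d z xE nd; exists s; split=> // z' z'P.
  have Xdz' := z'P d ds; have CE := sz' z' z'P.
  by split=> -[_ nC]; split=> //; [move/CE|move/CE].
- move=> C D [CX QC] [DX QD]; split; first by move=> y [/CX].
  move=> {}x Xx; have [n xn] := QC x Xx; have [m xm] := QD x Xx.
  exists (maxn n m) => d z xE; rewrite geq_max => /andP[nd md].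
  have [s [ds sz sz']] := xn d z xE nd; have [t [dt tz tz']] := xm d z xE md.
  exists (s ++ t); split=> [|b|z' z'P]; first by rewrite mem_cat ds.
    by rewrite mem_cat => /orP[/sz|/tz].
  have CE : C (wcat d z') <-> C x by apply: sz' => b bs; apply: z'P; rewrite mem_cat bs.
  have DE : D (wcat d z') <-> D x by apply: tz' => b bt; apply: z'P; rewrite mem_cat bt orbT.
  by split=> -[??]; split; by [apply/CE|apply/DE].
move=> _ [v [w [_ _ ->]]]; split; first by move=> y [z [->]].
move=> {}x Xx; have [[y xy]|nxy] := pselect (exists y, x = wcat w y); last first.
  exists (size w) => d z xE wd; exists [:: d].
  have [] := single d z; rewrite -?xE// => ??; split=> // z' _.
  split=> [[y [dy _ _]]|[y [xy _ _]]]; exfalso; apply: nxy; last by exists y.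
  by have [e dE _] := wcat_prefix wd dy; exists (wcat e z); rewrite xE dE wcat_cat.
have [Xvy|nXvy] := pselect (X (wcat v y)).
  exists (size w) => d z xE wd; have [e dE yE] : exists2 e, d = w ++ e & y = wcat e z.
    by apply: wcat_prefix => //; rewrite -xE.
  exists [:: d; v ++ e]; split=> [|b|z' z'P]; first exact: mem_head.
    rewrite !inE => /orP[/eqP ->|/eqP ->]; first by rewrite -xE.
    by rewrite wcat_cat -yE.
  have Xd := z'P _ (mem_head _ _).
  have Xve : X (wcat (v ++ e) z') by apply: z'P; rewrite !inE eqxx orbT.
  split=> _; first by exists y; rewrite -xy.
  by exists (wcat e z'); rewrite -!wcat_cat -dE.
have [k kP] := subshift_open_compl nXvy.
exists (size w + k)%N => d z xE wd; have [e dE yE] : exists2 e, d = w ++ e & y = wcat e z.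
  by apply: wcat_prefix; rewrite -?xE//; lia.
exists [:: d]; have [] := single d z; rewrite -?xE// => ??; split=> // z' _.
split=> [[y' [+ _ Xvy']]|[y' [+ _ Xvy']]]; last first.
  by rewrite xy => /wcat_inj yy; rewrite -yy in Xvy'.
rewrite dE wcat_cat => /wcat_inj y'E; exfalso; apply: kP Xvy' => i ik.
rewrite -y'E yE -!wcat_cat; apply: wcat_agree.
by move: wd; rewrite dE !size_cat; lia.
Qed.

Lemma algebra_followers (s : seq (seq A)) : U (followers S [set` s]).
Proof.
elim: s => [|b s IHs].
  have := @algebra_setT _ S; congr U; apply/seteqP; split=> [y Xy|y []//]; by split.
have := algebra_setI (algebra_preimage_wcat b (@algebra_setT _ S)) IHs.
congr U; apply/seteqP; split=> y.
  move=> [Xby [Xy ys]]; split=> // c; rewrite /= inE => /predU1P[->|/ys//].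
  by split.
move=> [Xy ys]; split; first by have [] := ys b (mem_head _ _).
by split=> // c cs; apply: ys; rewrite /= inE [X in _ || X]cs orbT.
Qed.

Lemma Cost_some (B : set (seq A)) x n : Cost S B x = Some n -> cost_set S B x n.
Proof.
by rewrite /Cost; case: pselect => // h [<-]; case: ex_minnP => m /asboolP.
Qed.

Lemma Cost_le (B : set (seq A)) x n : cost_set S B x n ->
  exists2 m, Cost S B x = Some m & (m <= n)%N.
Proof.
move=> Bn; rewrite /Cost; case: pselect => [h|]; last by case; exists n; apply/asboolP.
by exists (ex_minn h) => //; case: ex_minnP => m _; apply; apply/asboolP.
Qed.

(** For every ultrafilter [xi] the orbit of [xi] meets [O_E], with [E] the intersection of the
    follower sets. So [xi = w z] with [v z] in [O_E], and [|w| + |v|] bounds the cost on a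
    whole neighbourhood of [xi]. Sets of bounded cost are closed under union, so compactness
    gives a uniform bound. *)
Lemma minimal_hyper_cofinal : minimal_groupoid (hatsigma_dom S) sh -> hyper_cofinal S.
Proof.
move=> /minimalP minG B /finite_seqP[s ->] _ [y yB].
pose E := followers S [set` s]; have UE : U E := algebra_followers s.
apply: (@stone_compact_ind _ S (fun C => exists N, forall x, C x ->
  exists2 n, Cost S [set` s] x = Some n & (n <= N)%N)).
- by exists 0%N.
- move=> C D _ _ [N CN] [M DM]; exists (maxn N M) => x [/CN|/DM] [n nE nN]; exists n => //.
    by rewrite leq_max nN.
  by rewrite leq_max nN orbT.
move=> xi; have [g [gs gE]] := minG xi E UE (ex_intro _ y yB).
have [v [w [z [vz wz _]]]] := std_ex_at g; rewrite gs in wz.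
have UvE := algebra_preimage_wcat v UE.
exists (cat_set S w (wcat v @^-1` E)); last first.
  by apply/mem_cat_set => //; exists z => //; exact/(ucat_mem vz).
exists (size w + size v)%N => x /cat_setP[t [xE Xwt [Xvt Evt]]].
apply: Cost_le; exists w, v; split=> //; [exact: language_wcat Xwt|exact: language_wcat Xvt|].
move=> b /Evt[_ Xbvt]; exists t; split=> //; first by rewrite wcat_cat.
Qed.

(** A nonempty [E] contains [d F], where [F] is a nonempty intersection of finitely many follower
    sets. A uniform bound on the cost, over a finite alphabet, means that finitely many
    sets of the form [v (w^-1 F)] cover [X]. By primeness [xi] contains one of them, so
    [xi = v zeta] with [w zeta] in [O_F], and [d w zeta] is a point of the orbit of [xi] in [O_E]. *)
Lemma hyper_cofinal_minimal : hyper_cofinal S -> minimal_groupoid (hatsigma_dom S) sh.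
Proof.
move=> hc; apply/minimalP => xi E UE [x Ex]; have Xx := algebra_sub UE Ex.
have [n xn] := algebra_local UE Xx.
have [s [ds sz sE]] := xn _ _ (esym (wcat_factor x n)) (eq_leq (esym (size_mkseq _ n))).
set d := Defs.factor x 0 n in ds sE; set z := iter n shift x in sz.
have [|b /sz Xbz||N hN] := hc [set` s].
- exact: finite_seq.
- exact: language_wcat Xbz.
- exists z; split=> [|b /sz Xbz]; first exact: iter_shift_subshift.
  by split=> //; exact: wcat_subshift Xbz.
have UF := algebra_followers s.
pose F (p : N.-bseq A * N.-bseq A) := cat_set S p.1 (wcat p.2 @^-1` followers S [set` s]).
have UpF p : U (F p) by apply: algebra_cat_set; exact: algebra_preimage_wcat.
have [y Xy|[v w] _ /mem_cat_set[|zeta vz wF]] :=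
    @stone_bigcup _ S xi _ (enum {: N.-bseq A * N.-bseq A}) F UpF.
- have [m /Cost_some[v [w [_ _ mE yB]]] mN] := hN y Xy.
  have vN : (size v <= N)%N by lia.
  have wN : (size w <= N)%N by lia.
  exists (Bseq vN, Bseq wN); first by rewrite mem_enum.
  have [t [yE Xvt Xdwt]] := yB d ds.
  apply/cat_setP; exists t; split=> //.
  have Xwt : X (wcat w t) by rewrite wcat_cat in Xdwt; exact: wcat_subshift Xdwt.
  split=> // b bs; split=> //.
  have [t' [yE' _ Xbwt]] := yB b bs; rewrite -wcat_cat.
  by have -> : t = t' by apply: (@wcat_inj _ v); rewrite -yE.
- exact: algebra_preimage_wcat.
have [eta weta] : exists eta, ucat w zeta eta.
  apply: ucat_ex; apply: (stone_subset wF) => [|t []//].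
  by apply: algebra_preimage_wcat; exact: algebra_setT.
have etaF : sval eta (followers S [set` s]) by exact/(ucat_mem weta).
have [theta dtheta] : exists theta, ucat d eta theta.
  apply: ucat_ex; apply: (stone_subset etaF) => [|t [_ /(_ d ds)[]]//].
  by apply: algebra_preimage_wcat; exact: algebra_setT.
have [/ucatP[_ e1] /ucatP[_ e2] /ucatP[_ e3]] := And3 vz weta dtheta.
have [|g [gr _ gs]] := @DR_ex _ S theta xi (size w + size d) (size v).
  by rewrite iterD e3 e2 e1.
exists g; split=> //; rewrite gr; apply/(ucat_mem dtheta) => //.
apply: (stone_subset etaF); first exact: algebra_preimage_wcat.
by move=> t [_ tP]; apply/sE => // b /tP[].
Qed.

End HyperCofinal.

(** * Finite subshifts *)

Section FinDimQuotient.
Variables (K : fieldType) (V : lmodType K) (mul : V -> V -> V) (Alg I : set V).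

(** The elements congruent modulo [I] to a combination of [l] form a subspace that contains
    [I] and [l]; the last hypothesis says that such a subspace is everything. *)
Lemma fin_dim_quotient_span (l : seq V) : ideal mul Alg I ->
  (forall s, s \in l -> Alg s) ->
  (forall P : V -> Prop, (forall u, I u -> P u) -> (forall s, s \in l -> P s) ->
    (forall u v, P u -> P v -> P (u + v)) -> (forall (c : K) u, P u -> P (c *: u)) ->
    forall a, Alg a -> P a) ->
  fin_dim_quotient Alg I.
Proof.
move=> [IA I0 ID IZ _] lA ind; exists (size l), (tnth (in_tuple l)); split.
  by move=> i; apply: lA; exact: mem_tnth.
move=> a; move: a; apply: ind => [u Iu|s sl|u v [c uc] [d vd]|k u [c uc]].
- by exists (fun=> 0); rewrite big1 ?subr0// => i _; rewrite scale0r.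
- have /tnthP[i si] : s \in in_tuple l by [].
  exists (fun j => (j == i)%:R); rewrite (bigD1 i)//= eqxx scale1r -si big1 ?addr0 ?subrr//.
  by move=> j /negPf ->; rewrite scale0r.
- exists (fun i => c i + d i).
  under eq_bigr do rewrite scalerDl; rewrite big_split /= opprD addrACA.
  exact: ID.
exists (fun i => k * c i); under eq_bigr do rewrite -scalerA.
by rewrite -scaler_sumr -scalerBr; exact: IZ.
Qed.

End FinDimQuotient.

Section FiniteSubshift.
Variables (K : fieldType) (A : finType) (S : subshift A).
Local Notation X := (subshift_set S).
Local Notation U := (subshift_algebra_sets S).
Local Notation Y := (subshift_stone S).
Local Notation G := (DR (hatsigma_dom S) (hatsigma S)).
Local Notation V := (G -> K^o).
Local Notation AK := (subshift_algebra K S).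
Local Notation mul := (subshift_mul K S).
Local Notation gr := (subshift_deg K S).
Implicit Types (x y : nat -> A) (u v w : seq A) (B C E P : set (nat -> A)).
Implicit Types (xi eta zeta theta : Y) (d g h k p q : G) (f a b : V) (D : set G).
Local Notation sh := (hatsigma S).

Lemma transitiveP : X !=set0 -> transitive_groupoid (hatsigma_dom S) sh <->
  forall xi eta, exists g, DR_range g = xi /\ DR_source g = eta.
Proof.
move=> [x Xx]; split=> [[O [_ Ouniq]] xi eta|conn].
  have Oe : O = Defs.orbit (hatsigma_dom S) sh eta by apply: Ouniq; exists eta.
  have Ox : O = Defs.orbit (hatsigma_dom S) sh xi by apply: Ouniq; exists xi.
  have [g [gr' _ gs]] := DR_unit_ex xi.
  have : Defs.orbit (hatsigma_dom S) sh xi xi by exists g.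
  by rewrite -Ox Oe => -[h hs hr]; exists h.
have orbT eta : Defs.orbit (hatsigma_dom S) sh eta = setT.
  by apply/seteqP; split=> // xi _; have [g [gr' gs]] := conn xi eta; exists g.
by exists setT; split; [exists (principal Xx)|move=> O [eta ->]]; rewrite orbT.
Qed.

Lemma transitive_minimal : X !=set0 -> transitive_groupoid (hatsigma_dom S) sh ->
  minimal_groupoid (hatsigma_dom S) sh.
Proof.
move=> X0 /(transitiveP X0) conn; apply/minimalP => xi E UE [x Ex].
have [g [gr' gs]] := conn (principal (algebra_sub UE Ex)) xi.
by exists g; rewrite gr'.
Qed.

Hypothesis Xfin : finite_set X.

(** Otherwise [xi] would contain, for each of the finitely many points of [X], a set that
    misses this point. *)
Lemma principal_ex xi : exists2 x, X x & forall B, sval xi B -> B x.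
Proof.
apply: contrapT => nx.
have /choice[B BP] x : exists B, sval xi B /\ (X x -> ~ B x).
  have [Xx|nXx] := pselect (X x); last by exists X; split=> //; exact: stone_setT.
  apply: contrapT => nB; apply: nx; exists x => // B xB.
  by apply: contrapT => nBx; apply: nB; exists B.
have [s Xs] := (finite_seqP _).1 Xfin.
have [i|x|i _ xi'] := @stone_bigcup _ S xi _ s (fun x => X `\` B x).
- by apply: algebra_setC; have [/stone_algebra] := BP i.
- move=> Xx; exists x; first by rewrite Xs in Xx.
  by split=> //; have [_] := BP x; exact.
have [xB _] := BP i.
by have [x [? []]] := stone_nonempty (stone_setI xB xi').
Qed.

Lemma stone_finite : finite_set [set: Y].
Proof.
have /choice[f fP] : forall xi, exists x, X x /\ forall B, sval xi B -> B x.
  by move=> xi; have [x] := principal_ex xi; exists x.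
rewrite (_ : setT = f @^-1` X); last first.
  by apply/seteqP; split=> // xi _; have [] := fP xi.
apply: finite_preimage => // xi eta _ _ fe.
have [Xx xP] := fP xi; have [_ eP] := fP eta; rewrite -fe in eP.
have pr zeta : (forall B, sval zeta B -> B (f xi)) -> zeta = principal Xx.
  by move=> zP; apply: stone_ext => B zB; split; [exact: stone_algebra zB|exact: zP].
exact: (etrans (pr xi xP) (esym (pr eta eP))).
Qed.

(** A finite Hausdorff space is discrete. *)
Lemma stone_isolated xi : exists2 B, sval xi B & forall eta, sval eta B -> eta = xi.
Proof.
have [l lY] := (finite_seqP _).1 stone_finite.
suff [B xB BP] : exists2 B, sval xi B & forall eta, eta \in l -> sval eta B -> eta = xi.
  by exists B => // eta; apply: BP; have : [set: Y] eta by []; rewrite lY.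
elim: l {lY} => [|eta l [B xB BP]]; first by exists X => //; exact: stone_setT.
have [->|ne] := pselect (eta = xi).
  by exists B => // zeta; rewrite inE => /predU1P[->|/BP].
have [C xC nC] : exists2 C, sval xi C & ~ sval eta C.
  apply: contrapT => nC; apply: ne; symmetry; apply: stone_ext => C xC.
  by apply: contrapT => eC; apply: nC; exists C.
exists (B `&` C); first exact: stone_setI.
have [UB UC] := (stone_algebra xB, stone_algebra xC).
move=> zeta; rewrite inE => /predU1P[->|zl] zBC.
  by exfalso; apply: nC; apply: (stone_subset zBC) => //; exact: subIsetr.
by apply: BP => //; apply: (stone_subset zBC) => //; exact: subIsetl.
Qed.

Lemma minimal_transitive : X !=set0 -> minimal_groupoid (hatsigma_dom S) sh ->
  transitive_groupoid (hatsigma_dom S) sh.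
Proof.
move=> X0 /minimalP minG; apply/(transitiveP X0) => xi eta.
have [B xB BP] := stone_isolated xi.
have [g [gs gB]] := minG eta B (stone_algebra xB) (stone_nonempty xB).
by exists g; split=> //; exact: BP.
Qed.

Lemma is_std_set1 g : is_std [set g].
Proof.
have [v [w [z [vz wz gd]]]] := std_ex_at g.
have [B zB BP] := stone_isolated z.
exists v, w, B; split; first exact: stone_algebra zB.
apply/seteqP; split=> [_ ->|h [z' [/BP -> vz' wz' hd]]]; first by exists z.
by apply: DR_ext; [exact: ucat_fun vz' vz|rewrite hd gd|exact: ucat_fun wz' wz].
Qed.

Lemma algebra_finite_support f : AK f -> finite_set [set g | f g != 0].
Proof.
move=> /algebra_range_finite Ff.
apply: (@sub_finite_set _ _ (\bigcup_(xi in [set: Y]) [set g | DR_range g = xi /\ f g != 0])).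
  by move=> g fg; exists (DR_range g).
by apply: bigcup_finite => [|xi _]; [exact: stone_finite|exact: Ff].
Qed.

Lemma algebra_sum_set1 f : AK f -> exists2 l : seq G, (forall g, g \in l -> f g != 0) &
  f = \sum_(g <- l) f g *: (\1_[set g] : V).
Proof.
move=> /algebra_finite_support/finite_seqP[l fl]; exists (undup l).
  by move=> g; rewrite mem_undup => gl; have : [set` l] g by []; rewrite -fl.
apply/funext => g; rewrite fct_sumE.
have [gl|gl] := boolP (g \in undup l).
  rewrite (bigD1_seq g) ?undup_uniq//= big1 => [|h hg].
    by rewrite addr0 -[RHS]/(f g * \1_[set g] g) indic_in// mulr1.
  rewrite -[LHS]/(f h * \1_[set h] g) indic_out ?mulr0// => gh.
  by rewrite gh eqxx in hg.
rewrite big1_seq => [|h /andP[_ hl]].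
  apply/eqP; apply: contraNT gl => fg; rewrite mem_undup.
  by have : [set g | f g != 0] g by []; rewrite fl.
rewrite -[LHS]/(f h * \1_[set h] g) indic_out ?mulr0// => gh.
by rewrite gh hl in gl.
Qed.

(** Used for the identity and for the opposite, to find the points of highest and of lowest
    degree in the support of [f] between two given units. *)
Lemma extremal_degree (phi : int -> int) f g : (forall n, `|phi n| = `|n|) ->
  AK f -> f g != 0 -> exists h,
  [/\ DR_range h = DR_range g, DR_source h = DR_source g, f h != 0 &
   forall k, DR_range k = DR_range g -> DR_source k = DR_source g -> f k != 0 ->
     phi (DR_deg k) <= phi (DR_deg h)].
Proof.
move=> phiN Af fg; have [N fN] := degree_bounded Af.
pose P n := `[< exists h, [/\ DR_range h = DR_range g, DR_source h = DR_source g,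
   f h != 0 & phi (DR_deg h) + N%:Z = n%:Z] >].
have deg_nat h : f h != 0 -> exists n : nat, phi (DR_deg h) + N%:Z = n%:Z.
  move=> /fN hN; have := phiN (DR_deg h).
  by exists (absz (phi (DR_deg h) + N%:Z)); lia.
have exP : exists n, P n.
  by have [n gn] := deg_nat g fg; exists n; apply/asboolP; exists g.
have bP n : P n -> (n <= N + N)%N.
  by move=> /asboolP[h [_ _ /fN hN hn]]; have := phiN (DR_deg h); lia.
case: (ex_maxnP exP bP) => n /asboolP[h [hr hs fh hn]] nmax.
exists h; split=> // k kr ks fk; have [m km] := deg_nat k fk.
by have := nmax m; rewrite -lez_nat -hn -km lerD2r; apply; apply/asboolP; exists k.
Qed.

Hypothesis conn : forall xi eta, exists g, DR_range g = xi /\ DR_source g = eta.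

(** Points are standard bisections, so [f] may be multiplied on both sides by the indicators
    of points [p] and [q] with [p g0 q = g]. The part of [f] between the ends of [g0]
    is then moved to the ends of [g], all degrees changing by the same amount. *)
Lemma ideal_translate (I : set V) f g0 g : ideal mul AK I -> I f -> f g0 != 0 ->
  exists f1, [/\ I f1, f1 g != 0 & forall h, f1 h != 0 ->
    [/\ DR_range h = DR_range g, DR_source h = DR_source g & exists k,
     [/\ DR_range k = DR_range g0, DR_source k = DR_source g0, f k != 0 &
         DR_deg h - DR_deg g = DR_deg k - DR_deg g0]]].
Proof.
move=> [IA _ _ _ IM] If fg0.
have [p [pr ps]] := conn (DR_range g) (DR_range g0).
have [t tP] := DR_comp_ex ps; have [_ tr td ts] := DR_compP tP.
have [|q qP] := @DR_ldiv _ _ t g; first by rewrite tr.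
have [tq _ qd qs] := DR_compP qP.
have [|k kP] := @DR_comp_ex _ _ g0 q; first by rewrite -ts.
have [_ kr kd ks] := DR_compP kP.
have pk : DR_comp p k g by apply: DR_comp_intro; rewrite ?kr ?ks ?kd//; lia.
have [sp sq] := (is_std_set1 p, is_std_set1 q).
have [[_ _ bp] [_ _ bq]] := (is_std_cob sp, is_std_cob sq).
exists (mul \1_[set p] (mul f \1_[set q])); split.
- have [_ If'] := IM _ _ (algebra_indic K sq) If.
  by have [] := IM _ _ (algebra_indic K sp) If'.
- by rewrite (conv_indicl _ bp _ pk)// (conv_indicr _ bq _ kP).
move=> h /conv_neq0[p' [k' [ph pp /conv_neq0[k'' [q' [kq fk qq]]]]]].
have pp' := indic_neq0 pp; have qq' := indic_neq0 qq; rewrite /= in pp' qq'; subst p' q'.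
have [e1 e2 e3 e4] := DR_compP ph; have [e5 e6 e7 e8] := DR_compP kq.
split; rewrite ?e2 ?e4 ?e8//.
exists k''; split=> //; [by rewrite -e6 -e1|by rewrite e5 -tq|lia].
Qed.

(** The algebra is spanned by the indicators of points, and between two given units it looks like
    Laurent polynomials: a nonzero [f] in [I] can be translated so that its term of highest
    degree, or its term of lowest degree, sits at any given point. As in a division with
    remainder, modulo [I] every indicator of a point reduces to those of the finitely
    many points whose degree lies in a window as wide as the spread of degrees in [f]. *)
Lemma transitive_just_infinite : X !=set0 -> just_infinite mul AK.
Proof.
move=> [x Xx]; split.
  by apply: (@quotient_infinite_dim _ _ _ _ (principal Xx)) => _ -> g _.
move=> I idI I0; have [IA I00 ID IZ IM] := idI.
have [f If [g0 fg0]] : exists2 f, I f & exists g, f g != 0.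
  apply: contrapT => nI; apply: I0; apply/seteqP; split=> [f If|_ ->//].
  apply/funext => g; apply/eqP; apply: contrapT => /negP fg.
  by apply: nI; exists f => //; exists g.
have [gt [gtr gts fgt gtmax]] := extremal_degree (phi := id) (fun _ => erefl) (IA _ If) fg0.
have [gb [gbr gbs fgb gbmin']] := extremal_degree (@normrN _ _) (IA _ If) fg0.
have gbmin k : DR_range k = DR_range g0 -> DR_source k = DR_source g0 -> f k != 0 ->
    DR_deg gb <= DR_deg k.
  by move=> kr ks fk; rewrite -lerN2; exact: gbmin'.
have btL := gbmin gt gtr gts fgt.
(* M is the spread of the degrees of f between the ends of g0. *)
have [M ML] : exists M : nat, DR_deg gt - DR_deg gb = M%:Z.
  by exists (absz (DR_deg gt - DR_deg gb)); lia.
pose T : set G := [set g | exists n : nat, (n <= M)%N /\ DR_deg g = n%:Z].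
have Tfin : finite_set T.
  rewrite (_ : T = sval @^-1` (([set: Y] `*` ((fun n : nat => n%:Z) @` `I_M.+1)) `*` [set: Y])).
    apply: finite_preimage.
      by move=> g h _ _ gh; apply: DR_ext; rewrite /DR_range /DR_deg /DR_source gh.
    by do 2?[apply: finite_setX]; do ?[exact: stone_finite|exact/finite_image/finite_II].
  apply/seteqP; split=> g; first by move=> [n [nM gn]]; do !split=> //; exists n.
  by move=> [[_ [n nM gn]] _]; exists n.
have [l Tl] := (finite_seqP _).1 Tfin.
apply: (@fin_dim_quotient_span K V mul AK I [seq (\1_[set g] : V) | g <- l] idI).
  by move=> s /mapP[g _ ->]; apply: algebra_indic; exact: is_std_set1.
move=> P PI Pl PD PZ.
have Psupp a : AK a -> (forall g, a g != 0 -> P \1_[set g]) -> P a.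
  move=> /algebra_sum_set1[s sa aE] aP; rewrite aE big_seq.
  by apply: (big_ind P) => // [|g gs]; [exact: PI _ I00|apply: PZ; apply: aP; exact: sa].
(* Induction on the distance n of the degree of g from the window from 0 to M. *)
suff Pg n g : (DR_deg g <= n%:Z + M%:Z) -> (- n%:Z <= DR_deg g) -> P \1_[set g].
  by move=> a Aa; apply: Psupp => // g _; apply: (Pg `|DR_deg g|%N); lia.
elim: n g => [|n IHn] g gn ng.
  apply: Pl; apply/mapP; exists g => //.
  suff : T g by rewrite Tl.
  by exists `|DR_deg g|%N; split; lia.
(* Subtract a multiple of the translate of f that moves g1 to g. With g1 of highest or
   lowest degree, the remaining terms lie on the side of g where the window is. *)
have reduce g1 : f g1 != 0 -> DR_range g1 = DR_range g0 -> DR_source g1 = DR_source g0 ->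
    (forall k, DR_range k = DR_range g0 -> DR_source k = DR_source g0 -> f k != 0 ->
      DR_deg k <> DR_deg g1 -> - n%:Z <= DR_deg g + DR_deg k - DR_deg g1 <= n%:Z + M%:Z) ->
    P \1_[set g].
  move=> fg1 g1r g1s H; have [f1 [If1 f1g f1P]] := ideal_translate g idI If fg1.
  have Ag : AK \1_[set g] by apply: algebra_indic; exact: is_std_set1.
  rewrite (_ : \1_[set g] = (\1_[set g] - (f1 g)^-1 *: f1) + (f1 g)^-1 *: f1); last first.
    by rewrite subrK.
  apply: (PD); last by apply: PZ; exact: PI.
  apply: Psupp.
    by rewrite -scaleNr; apply: algebraD => //; apply: algebraZ; exact: IA.
  move=> h; rewrite -[(_ - _) h]/((\1_[set g] : V) h - (f1 g)^-1 * f1 h) => ah.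
  have hg : h <> g.
    by move=> hg; move: ah; rewrite hg indic_in// mulVf// subrr eqxx.
  move: ah; rewrite indic_out// sub0r oppr_eq0 mulf_eq0 negb_or => /andP[_ /f1P].
  move=> [hr hs [k [kr ks fk hd]]].
  rewrite g1r in kr; rewrite g1s in ks.
  have /andP[H1 H2] : - n%:Z <= DR_deg g + DR_deg k - DR_deg g1 <= n%:Z + M%:Z.
    by apply: H => // kd; apply: hg; apply: DR_ext => //; lia.
  by apply: IHn; lia.
have [gM|gM] := leP (DR_deg g) M%:Z; last first.
  apply: (reduce gt) => // k kr ks fk kg.
  by have := gtmax k kr ks fk; have := gbmin k kr ks fk; lia.
have [g0'|g0'] := leP 0 (DR_deg g); first by apply: IHn; lia.
apply: (reduce gb) => // k kr ks fk kg.
by have := gtmax k kr ks fk; have := gbmin k kr ks fk; lia.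
Qed.

End FiniteSubshift.

Theorem corollary6p26 (K : fieldType) (A : finType) (X : subshift A)
    (X_neq0 : X !=set0) :
  [<-> graded_just_infinite (subshift_mul K X) (subshift_algebra K X)
         (subshift_deg K X);
       minimal_groupoid (hatsigma_dom X) (hatsigma X);
       graded_simple (subshift_mul K X) (subshift_algebra K X)
         (subshift_deg K X);
       hyper_cofinal X]
  /\
  (finite_set X ->
   [<-> graded_just_infinite (subshift_mul K X) (subshift_algebra K X)
          (subshift_deg K X);
        minimal_groupoid (hatsigma_dom X) (hatsigma X);
        graded_simple (subshift_mul K X) (subshift_algebra K X)
          (subshift_deg K X);
        hyper_cofinal X;
        just_infinite (subshift_mul K X) (subshift_algebra K X);
        transitive_groupoid (hatsigma_dom X) (hatsigma X)]).
Proof.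
have gji_min := @graded_just_infinite_minimal K A X.
have min_simple := @minimal_graded_simple K A X.
have simple_gji := @graded_simple_just_infinite K A X X_neq0.
have hc_min := @hyper_cofinal_minimal A X.
have min_hc := @minimal_hyper_cofinal A X.
split=> [|Xfin]; first by tfae; tauto.
have min_tr := minimal_transitive Xfin X_neq0.
have tr_min := transitive_minimal X_neq0.
have tr_ji : transitive_groupoid (hatsigma_dom X) (hatsigma X) ->
    just_infinite (subshift_mul K X) (subshift_algebra K X).
  move=> /(transitiveP X_neq0) conn.
  exact: (@transitive_just_infinite K A X Xfin conn X_neq0).
have ji_gji : just_infinite (subshift_mul K X) (subshift_algebra K X) ->
    graded_just_infinite (subshift_mul K X) (subshift_algebra K X) (subshift_deg K X).
  by move=> [inf ji]; split=> // J [idJ _]; exact: ji.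
by tfae; tauto.
Qed.
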